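(* Let $p>0$ be real, let $\sigma(t)=\frac{p+t}{p-t}$, and for each integer $j\ge 1$ let $\lambda_j$ be the root of $\tan(\pi x)=-x/p$ lying in $(j-\tfrac12,j)$. Let $f(z)$ be analytic for $\operatorname{Re}(z)\ge 0$, and write $z=x+iy$. Suppose that $$\int_0^\infty |f(x+iy)|\,dx<\infty \quad (y\in\mathbb{R}),$$ and that this integral is bounded as $|y|\to\infty$. Assume that $$\lim_{y\to\infty}|f(x\pm iy)|e^{-2\pi y}=0$$ uniformly in $x$ on every finite interval (in $x\ge 0$), that $$\lim_{r\to\infty}\int_{-\infty}^{\infty}e^{-2\pi|y|}|f(r+iy)|\,dy=0,$$ and that $\sum_{j=1}^\infty f(\lambda_j)$ converges. Then $$\sum_{j=1}^{\infty}\frac{p^2+\lambda_j^2}{p\left(p+\frac1\pi\right)+\lambda_j^2}f(\lambda_j)=-\frac12\,\frac{1}{1+\frac{1}{\pi p}}f(0)+\int_0^\infty f(x)\,dx+i\int_0^\infty\frac{f(ix)-f(-ix)}{\sigma(x)e^{2\pi x}-1}\,dx.$$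
   Context: There is exactly one root $\lambda_j$ of $\tan(\pi x)=-x/p$ in each interval $(j-\tfrac12,j)$, $j\ge1$. The factor $\frac{1}{\sigma(x)e^{2\pi x}-1}$ is understood as $\frac{p-x}{(p+x)e^{2\pi x}-(p-x)}$; in particular it is $0$ at $x=p$, where $\sigma$ has a pole. Integrals over $[0,\infty)$ in the conclusion are understood as improper integrals. *)

(* Defs.v *)
From Stdlib Require Import Reals Lra.
From Coquelicot Require Import Coquelicot.

Open Scope R_scope.

(* [f] is total on [C]; only its values near the closed half-plane matter.
   Analytic on that non-open set means complex differentiable on an open
   neighbourhood of each of its points. *)
Definition analytic_right_half_plane (f : C -> C) : Prop :=
  forall z : C, 0 <= Re z ->
    locally (T := C_UniformSpace) z
      (fun w => ex_derive (K := C_AbsRing) (V := C_NormedModule) f w).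

Definition sigma (p t : R) : R := (p + t) / (p - t).

(* The factor 1 / (sigma(x) e^(2 pi x) - 1) with the pole of sigma at x = p
   cleared, so that it vanishes there; see [kernel_sigma].  At x = 0 it has a
   pole and Rocq gives it a junk value, which does not affect integrals. *)
Definition kernel (p x : R) : R :=
  (p - x) / ((p + x) * exp (2 * PI * x) - (p - x)).

Lemma kernel_sigma (p x : R) : 0 < p -> 0 < x -> x <> p ->
  kernel p x = / (sigma p x * exp (2 * PI * x) - 1).
Proof.
intros Hp Hx Hxp; unfold kernel, sigma.
assert (He : 1 < exp (2 * PI * x)).
{ rewrite <- exp_0; apply exp_increasing.
  apply Rmult_lt_0_compat; [pose proof PI_RGT_0; lra | exact Hx]. }
assert (Hd : (p + x) * exp (2 * PI * x) - (p - x) <> 0).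
{ assert ((p + x) * 1 < (p + x) * exp (2 * PI * x))
    by (apply Rmult_lt_compat_l; lra).
  lra. }
field; repeat split; try lra.
Qed.

(* Main.v *)
Require Import Defs.
From Stdlib Require Import Reals Lra Lia ClassicalEpsilon.
From Coquelicot Require Import Coquelicot.
Open Scope R_scope.

(** The sum is a sum of residues.  Put
    [N z = (p + i z) e^(2 pi i z)] and [D z = p - i z - N z].  Since
    [|p + i z|^2 - |p - i z|^2 = - 4 p Im z], the two terms of [D] have
    different sizes off the real axis, and on it
    [D x] is a nonzero multiple of [p sin (pi x) + x cos (pi x)]; so the zeros
    of [D] with nonnegative real part are [0] and the [lambda j], and they are
    simple.  The quotient [h = N / D] has residue [(i / (2 pi)) w] there, [w]
    being the weight in the series.  It decays like [e^(-2 pi y)] in the upper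
    half-plane, while in the lower half-plane it is [- 1 - h] that decays; the
    two are exchanged by reflection in the real axis, and on the imaginary axis
    both reduce to the kernel of the last integral.

    Integrate [f h] over the rectangle [0, n] x [d, Y] and [f (- 1 - h)] over
    [0, n] x [-Y, -d].  Both functions are holomorphic there, so both integrals
    vanish ([Goursat]); no continuity of the derivative is assumed, hence the
    proof by bisection.  In the difference of the two identities
    ([contour_identity]) the left sides give the integral over the imaginary
    axis, and the sides facing the real axis give the jump of [f h] across it
    together with [- f].

    As [d] tends to [0], only the poles contribute to the jump
    ([jump_limit]).  Subtracting the principal parts leaves a function with a
    limit at every point of the segment [0, n], so its jump tends uniformly to
    [0]; a principal part [c / (z - m)] jumps by a multiple of the Poisson
    kernel, whose integral is an arctangent.  An interior pole thus receives
    the full residue, while the pole at the end point [0] receives half of it,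
    which is the origin of the term in [f 0].  For fixed [n] the outer
    horizontal sides vanish as [Y] grows and the right sides converge
    absolutely, so the integral over the imaginary axis converges
    ([truncated_identity], [caps_limit], [side_limit]).  Then [n] tends to
    infinity; the lines [Re z = n] stay away from the poles, the kernel is
    bounded by [(p + 2) e^(-2 pi |y|)] on them, and the right sides disappear by
    the hypothesis on the vertical integrals. *)

(** * Limits and complex derivatives *)

(** Convergence measured by the modulus, the source filter being arbitrary.
    [C] carries two uniform structures, as a product and as a normed ring; a
    formulation in terms of [Cmod] serves both. *)
Definition Clim {T : Type} (F : (T -> Prop) -> Prop) (f : T -> C) (l : C) : Prop :=
  forall eps : R, 0 < eps -> F (fun x => Cmod (f x - l) < eps).

Lemma Cmod_sub_comm (x y : C) : Cmod (x - y) = Cmod (y - x).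
Proof. rewrite <- Cmod_opp. f_equal. ring. Qed.

Lemma Cmod_triangle_sub (x y z : C) : Cmod (x - z) <= Cmod (x - y) + Cmod (y - z).
Proof. replace (x - z)%C with ((x - y) + (y - z))%C by ring. apply Cmod_triangle. Qed.

Lemma Cmod_sub_le (x y : C) : Cmod (x - y) <= Cmod x + Cmod y.
Proof. rewrite <- (Cmod_opp y). apply Cmod_triangle. Qed.

Lemma Cmod_fst (z : C) : Rabs (fst z) <= Cmod z.
Proof. eapply Rle_trans; [apply Rmax_l | apply Rmax_Cmod]. Qed.

Lemma Cmod_snd (z : C) : Rabs (snd z) <= Cmod z.
Proof. eapply Rle_trans; [apply Rmax_r | apply Rmax_Cmod]. Qed.

Lemma Cmod_le_sum (z : C) : Cmod z <= Rabs (fst z) + Rabs (snd z).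
Proof.
replace z with (RtoC (fst z) + Ci * RtoC (snd z))%C at 1
  by (destruct z; unfold RtoC, Ci, Cplus, Cmult; simpl; f_equal; ring).
eapply Rle_trans; [apply Cmod_triangle|].
rewrite Cmod_mult, !Cmod_R, Cmod_Ci; lra.
Qed.

Lemma ball_Cmod (x y : C) (eps : posreal) :
  Cmod (y - x) < eps -> ball (M := C_UniformSpace) x eps y.
Proof. exact (C_NormedModule_mixin_compat1 x y eps). Qed.

Lemma Cmod_ball (x y : C) (eps : posreal) :
  ball (M := C_UniformSpace) x eps y -> Cmod (y - x) < 2 * eps.
Proof.
intros [H1 H2].
eapply Rle_lt_trans; [apply Cmod_le_sum|].
assert (Rabs (fst (y - x)%C) < eps) by exact H1.
assert (Rabs (snd (y - x)%C) < eps) by exact H2. lra.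
Qed.

Lemma Clim_filterlim {T : Type} (F : (T -> Prop) -> Prop) {FF : Filter F}
  (f : T -> C) (l : C) :
  Clim F f l <-> filterlim f F (locally (T := C_UniformSpace) l).
Proof.
split.
- intros H. apply filterlim_locally. intros eps.
  generalize (H eps (cond_pos eps)). apply filter_imp. intros x; apply ball_Cmod.
- intros H eps He.
  assert (He2 : 0 < eps / 2) by lra.
  generalize (proj1 (filterlim_locally _ _) H (mkposreal _ He2)).
  apply filter_imp. intros x Hx. apply Cmod_ball in Hx. simpl in Hx. lra.
Qed.

(** The type is annotated so that points are seen in [C] by [ring] and [field]. *)
Definition nhds (z : C) : (C -> Prop) -> Prop := locally (T := C_UniformSpace) z.

#[local] Instance nhds_filter (z : C) : ProperFilter (nhds z).
Proof. exact (locally_filter (T := C_UniformSpace) z). Qed.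

Lemma nhds_Cmod (z : C) (P : C -> Prop) :
  nhds z P <->
  exists d : R, 0 < d /\ forall w, Cmod (w - z) < d -> P w.
Proof.
split.
- intros [d Hd]. exists d. split; [apply cond_pos|].
  intros w Hw. apply Hd. now apply ball_Cmod.
- intros [d [Hd H]].
  assert (Hd2 : 0 < d / 2) by lra.
  exists (mkposreal _ Hd2). intros y Hy. apply H.
  apply Cmod_ball in Hy. simpl in Hy. lra.
Qed.

Lemma Clim_eq {T : Type} (F : (T -> Prop) -> Prop) (f : T -> C) (a b : C) :
  a = b -> Clim F f a -> Clim F f b.
Proof. now intros ->. Qed.

Section ClimTheory.
Context {T : Type} {F : (T -> Prop) -> Prop} {FF : Filter F}.

Lemma Clim_ext_loc (f g : T -> C) (l : C) :
  F (fun x => f x = g x) -> Clim F f l -> Clim F g l.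
Proof.
intros H Hf eps He. generalize (filter_and _ _ H (Hf eps He)).
apply filter_imp. intros x [-> Hx]; exact Hx.
Qed.

Lemma Clim_const (c : C) : Clim F (fun _ => c) c.
Proof.
intros eps He. apply filter_forall. intros _.
replace (c - c)%C with (RtoC 0) by ring. now rewrite Cmod_0.
Qed.

Lemma Clim_plus (f g : T -> C) (a b : C) :
  Clim F f a -> Clim F g b -> Clim F (fun x => f x + g x)%C (a + b)%C.
Proof.
intros Hf Hg eps He.
assert (He2 : 0 < eps / 2) by lra.
generalize (filter_and _ _ (Hf _ He2) (Hg _ He2)). apply filter_imp.
intros x [H1 H2].
replace (f x + g x - (a + b))%C with ((f x - a) + (g x - b))%C by ring.
eapply Rle_lt_trans; [apply Cmod_triangle|]. lra.
Qed.

Lemma Clim_mult (f g : T -> C) (a b : C) :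
  Clim F f a -> Clim F g b -> Clim F (fun x => f x * g x)%C (a * b)%C.
Proof.
intros Hf Hg eps He.
pose proof (Cmod_ge_0 a) as Ha. pose proof (Cmod_ge_0 b) as Hb.
set (K := 1 + Cmod a + Cmod b).
assert (HK : 0 < K) by (unfold K; lra).
assert (He1 : 0 < Rmin 1 (eps / K)).
{ apply Rmin_pos; [lra|]. now apply Rdiv_lt_0_compat. }
generalize (filter_and _ _ (Hf _ He1) (Hg _ He1)). apply filter_imp.
intros x [H1 H2].
pose proof (Rmin_l 1 (eps / K)). pose proof (Rmin_r 1 (eps / K)).
set (m := Rmin 1 (eps / K)) in *.
replace (f x * g x - a * b)%C
  with ((f x - a) * (g x - b) + a * (g x - b) + (f x - a) * b)%C by ring.
pose proof (Cmod_ge_0 (f x - a)). pose proof (Cmod_ge_0 (g x - b)).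
eapply Rle_lt_trans.
{ eapply Rle_trans; [apply Cmod_triangle|]. apply Rplus_le_compat_r, Cmod_triangle. }
rewrite !Cmod_mult.
apply Rlt_le_trans with (m * K).
{ unfold K. set (u := Cmod (f x - a)) in *. set (v := Cmod (g x - b)) in *.
  assert (u * v <= u * 1) by (apply Rmult_le_compat_l; lra).
  assert (Cmod a * v <= Cmod a * m) by (apply Rmult_le_compat_l; lra).
  assert (u * Cmod b <= m * Cmod b) by (apply Rmult_le_compat_r; lra).
  nra. }
replace eps with (eps / K * K) by (field; lra).
apply Rmult_le_compat_r; lra.
Qed.

Lemma Clim_opp (f : T -> C) (a : C) :
  Clim F f a -> Clim F (fun x => - f x)%C (- a)%C.
Proof.
intros Hf eps He. generalize (Hf eps He). apply filter_imp. intros x.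
replace (- f x - - a)%C with (- (f x - a))%C by ring. now rewrite Cmod_opp.
Qed.

Lemma Clim_minus (f g : T -> C) (a b : C) :
  Clim F f a -> Clim F g b -> Clim F (fun x => f x - g x)%C (a - b)%C.
Proof. intros Hf Hg. apply Clim_plus; [assumption | now apply Clim_opp]. Qed.

Lemma Clim_inv (f : T -> C) (a : C) :
  a <> RtoC 0 -> Clim F f a -> Clim F (fun x => / f x)%C (/ a)%C.
Proof.
intros Ha Hf eps He.
assert (Hpos : 0 < Cmod a) by now apply Cmod_gt_0.
assert (He1 : 0 < Rmin (Cmod a / 2) (eps * (Cmod a * Cmod a) / 2)).
{ apply Rmin_pos; [lra|]. apply Rdiv_lt_0_compat; [|lra]. repeat apply Rmult_lt_0_compat; assumption. }
generalize (Hf _ He1). apply filter_imp. intros x Hx.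
pose proof (Rmin_l (Cmod a / 2) (eps * (Cmod a * Cmod a) / 2)).
pose proof (Rmin_r (Cmod a / 2) (eps * (Cmod a * Cmod a) / 2)).
assert (Hfx : Cmod a / 2 < Cmod (f x)).
{ pose proof (Cmod_triangle_sub a (f x) 0).
  replace (a - 0)%C with a in H1 by ring. replace (f x - 0)%C with (f x) in H1 by ring.
  rewrite (Cmod_sub_comm a) in H1. lra. }
assert (Hfx0 : f x <> RtoC 0) by (apply Cmod_gt_0; lra).
replace (/ f x - / a)%C with (- (f x - a) / (f x * a))%C by (field; split; assumption).
rewrite Cmod_div by now apply Cmult_neq_0.
rewrite Cmod_opp, Cmod_mult.
apply Rmult_lt_reg_r with (Cmod (f x) * Cmod a); [apply Rmult_lt_0_compat; lra|].
unfold Rdiv. rewrite Rmult_assoc, Rinv_l, Rmult_1_r by (apply Rgt_not_eq, Rmult_lt_0_compat; lra).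
assert (eps * (Cmod a / 2 * Cmod a) < eps * (Cmod (f x) * Cmod a)).
{ apply Rmult_lt_compat_l; [assumption|]. apply Rmult_lt_compat_r; assumption. }
lra.
Qed.

Lemma Clim_div (f g : T -> C) (a b : C) :
  b <> RtoC 0 -> Clim F f a -> Clim F g b -> Clim F (fun x => f x / g x)%C (a / b)%C.
Proof. intros Hb Hf Hg. apply Clim_mult; [assumption | now apply Clim_inv]. Qed.

Lemma Clim_sum (t : nat -> T -> C) (a : nat -> C) (n : nat) :
  (forall k, (k <= n)%nat -> Clim F (t k) (a k)) ->
  Clim F (fun x => sum_n (G := C_AbelianMonoid) (fun k => t k x) n)
    (sum_n (G := C_AbelianMonoid) a n).
Proof.
induction n as [|n IH]; intros H.
- rewrite sum_O. apply (Clim_ext_loc (t O)).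
  + apply filter_forall; intros x. now rewrite sum_O.
  + now apply H.
- rewrite sum_Sn.
  apply (Clim_ext_loc (fun x => sum_n (G := C_AbelianMonoid) (fun k => t k x) n + t (S n) x)%C).
  + apply filter_forall; intros x. now rewrite sum_Sn.
  + apply Clim_plus; [apply IH; intros k Hk; apply H; lia | now apply H].
Qed.

Lemma Clim_le_filter (G : (T -> Prop) -> Prop) (f : T -> C) (l : C) :
  filter_le G F -> Clim F f l -> Clim G f l.
Proof. intros HG H eps He. apply HG, H, He. Qed.

Lemma Clim_squeeze (f : T -> C) (g : T -> R) (l : C) :
  F (fun x => Cmod (f x - l) <= g x) -> filterlim g F (locally 0) -> Clim F f l.
Proof.
intros H Hg eps He.
generalize (filter_and _ _ H (proj1 (filterlim_locally _ _) Hg (mkposreal _ He))).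
apply filter_imp. intros x [H1 H2].
assert (H3 : Rabs (g x - 0) < eps) by exact H2.
apply Rabs_def2 in H3. lra.
Qed.

End ClimTheory.

Lemma Clim_unique {T : Type} {F : (T -> Prop) -> Prop} {FF : ProperFilter F}
  (f : T -> C) (a b : C) : Clim F f a -> Clim F f b -> a = b.
Proof.
intros Ha Hb. apply Ceq_minus. apply Cmod_eq_0.
apply Rle_antisym; [|apply Cmod_ge_0]. apply Rnot_lt_le. intros H.
assert (H2 : 0 < Cmod (a - b) / 2) by lra.
destruct (filter_ex _ (filter_and _ _ (Ha _ H2) (Hb _ H2))) as [x [H3 H4]].
pose proof (Cmod_triangle_sub a (f x) b). rewrite (Cmod_sub_comm a (f x)) in H0. lra.
Qed.

Lemma Clim_comp {T U : Type} (F : (T -> Prop) -> Prop) (G : (U -> Prop) -> Prop)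
  (f : T -> U) (g : U -> C) (l : C) :
  filterlim f F G -> Clim G g l -> Clim F (fun x => g (f x)) l.
Proof. intros Hf Hg eps He. apply (Hf _ (Hg eps He)). Qed.

Definition Ccont (G : C -> C) (z : C) : Prop :=
  Clim (nhds z) G (G z).

Lemma Ccont_id (z : C) : Ccont (fun w => w) z.
Proof.
intros eps He. apply nhds_Cmod. exists eps. tauto.
Qed.

(** Complex differentiability in the sense of Caratheodory: the difference
    quotient extends continuously to [z].  The extended quotient is what
    remains of a function with a simple pole once the principal part is
    removed, see [pole_limit]. *)
Definition Cdiff (G : C -> C) (z : C) : Prop :=
  exists s : C -> C, Ccont s z /\
    nhds z (fun w => G w = (G z + s w * (w - z))%C).

Lemma Cdiff_cont (G : C -> C) (z : C) : Cdiff G z -> Ccont G z.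
Proof.
intros [s [Hs H]].
apply (Clim_ext_loc (fun w => G z + s w * (w - z))%C).
{ revert H. apply filter_imp. now intros w ->. }
apply (Clim_eq _ _ (G z + s z * (z - z))%C); [ring|].
apply Clim_plus; [apply Clim_const|]. apply Clim_mult; [exact Hs|].
apply Clim_minus; [apply Ccont_id | apply Clim_const].
Qed.

Lemma Cdiff_ext_loc (f g : C -> C) (z : C) :
  nhds z (fun w => f w = g w) -> Cdiff f z -> Cdiff g z.
Proof.
intros H [s [Hs Hf]]. exists s. split; [assumption|].
pose proof (locally_singleton _ _ H) as Hz. simpl in Hz.
generalize (filter_and _ _ H Hf). apply filter_imp. intros w [H1 H2].
now rewrite <- H1, <- Hz.
Qed.

Lemma Cdiff_const (c z : C) : Cdiff (fun _ => c) z.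
Proof.
exists (fun _ => RtoC 0). split; [apply Clim_const|].
apply filter_forall. intros w. ring.
Qed.

Lemma Cdiff_id (z : C) : Cdiff (fun w => w) z.
Proof.
exists (fun _ => RtoC 1). split; [apply Clim_const|].
apply filter_forall. intros w. ring.
Qed.

Lemma Cdiff_plus (f g : C -> C) (z : C) :
  Cdiff f z -> Cdiff g z -> Cdiff (fun w => f w + g w)%C z.
Proof.
intros [s [Hs Hf]] [t [Ht Hg]]. exists (fun w => s w + t w)%C. split.
- now apply Clim_plus.
- generalize (filter_and _ _ Hf Hg). apply filter_imp. intros w [-> ->]. ring.
Qed.

Lemma Cdiff_mult (f g : C -> C) (z : C) :
  Cdiff f z -> Cdiff g z -> Cdiff (fun w => f w * g w)%C z.
Proof.
intros Df Dg. pose proof (Cdiff_cont _ _ Dg) as Cg.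
destruct Df as [s [Hs Hf]], Dg as [t [Ht Hg]].
exists (fun w => s w * g w + f z * t w)%C. split.
- apply Clim_plus; apply Clim_mult; try assumption. apply Clim_const.
- generalize (filter_and _ _ Hf Hg). apply filter_imp. intros w [-> H]. rewrite H. ring.
Qed.

Lemma Cdiff_opp (f : C -> C) (z : C) : Cdiff f z -> Cdiff (fun w => - f w)%C z.
Proof.
intros H. apply (Cdiff_ext_loc (fun w => - RtoC 1 * f w)%C).
- apply filter_forall. intros w. ring.
- apply Cdiff_mult; [apply Cdiff_const | assumption].
Qed.

Lemma Cdiff_minus (f g : C -> C) (z : C) :
  Cdiff f z -> Cdiff g z -> Cdiff (fun w => f w - g w)%C z.
Proof. intros Hf Hg. apply Cdiff_plus; [assumption | now apply Cdiff_opp]. Qed.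

Lemma Ccont_nonzero (g : C -> C) (z : C) :
  Ccont g z -> g z <> RtoC 0 -> nhds z (fun w => g w <> RtoC 0).
Proof.
intros Hg H0. generalize (Hg _ (proj1 (Cmod_gt_0 _) H0)). apply filter_imp.
intros w Hw Hw0. rewrite Hw0 in Hw.
replace (0 - g z)%C with (- g z)%C in Hw by ring. rewrite Cmod_opp in Hw. lra.
Qed.

Lemma Cdiff_inv (g : C -> C) (z : C) :
  g z <> RtoC 0 -> Cdiff g z -> Cdiff (fun w => / g w)%C z.
Proof.
intros H0 Dg. pose proof (Cdiff_cont _ _ Dg) as Cg.
destruct Dg as [t [Ht Hg]].
exists (fun w => - t w / (g w * g z))%C. split.
- apply Clim_div; [now apply Cmult_neq_0 | now apply Clim_opp |].
  apply Clim_mult; [assumption | apply Clim_const].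
- generalize (filter_and _ _ Hg (Ccont_nonzero _ _ Cg H0)).
  apply filter_imp. intros w [Hw Hw0].
  assert (E : (t w * (w - z) = g w - g z)%C) by (rewrite Hw; ring).
  replace (- t w / (g w * g z) * (w - z))%C
    with (- (t w * (w - z)) / (g w * g z))%C by (field; split; assumption).
  rewrite E. field. split; assumption.
Qed.

Lemma Cdiff_div (f g : C -> C) (z : C) :
  g z <> RtoC 0 -> Cdiff f z -> Cdiff g z -> Cdiff (fun w => f w / g w)%C z.
Proof. intros H0 Hf Hg. apply Cdiff_mult; [assumption | now apply Cdiff_inv]. Qed.

Lemma Cdiff_comp (g f : C -> C) (z : C) :
  Cdiff f z -> Cdiff g (f z) -> Cdiff (fun w => g (f w)) z.
Proof.
intros Df. pose proof (proj1 (Clim_filterlim _ _ _) (Cdiff_cont _ _ Df)) as Cf.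
destruct Df as [s [Hs Hf]]. intros [t [Ht Hg]].
exists (fun w => t (f w) * s w)%C. split.
- apply Clim_mult; [|assumption]. exact (Clim_comp _ _ f t _ Cf Ht).
- generalize (filter_and _ _ Hf (Cf _ Hg)). apply filter_imp.
  intros w [H1 H2]. rewrite H2. replace (f w - f z)%C with (s w * (w - z))%C; [ring|].
  rewrite H1. ring.
Qed.

Lemma Cdiff_of_ex_derive (G : C -> C) (z : C) :
  ex_derive (K := C_AbsRing) (V := C_NormedModule) G z -> Cdiff G z.
Proof.
intros [l [_ H]].
specialize (H z (fun P HP => HP)).
exists (fun w => if Ceq_dec w z then l else (G w - G z) / (w - z))%C. split.
- unfold Ccont. destruct (Ceq_dec z z) as [_|n]; [|now elim n].
  intros eps He. assert (He2 : 0 < eps / 2) by lra.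
  specialize (H (mkposreal _ He2)). apply locally_C in H.
  revert H. apply filter_imp. intros w Hw.
  destruct (Ceq_dec w z) as [_|n].
  { replace (l - l)%C with (RtoC 0) by ring. now rewrite Cmod_0. }
  assert (Hn : (w - z)%C <> RtoC 0) by now apply Cminus_eq_contra.
  assert (Hpos := proj1 (Cmod_gt_0 _) Hn).
  assert (Hw' : Cmod (G w - G z - (w - z) * l) <= eps / 2 * Cmod (w - z)) by exact Hw.
  replace ((G w - G z) / (w - z) - l)%C
    with ((G w - G z - (w - z) * l) / (w - z))%C by (field; assumption).
  rewrite Cmod_div by assumption.
  apply Rle_lt_trans with (eps / 2); [|lra].
  apply Rmult_le_reg_r with (Cmod (w - z)); [assumption|].
  unfold Rdiv at 1. rewrite Rmult_assoc, Rinv_l by lra. lra.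
- apply filter_forall. intros w. destruct (Ceq_dec w z) as [->|n]; [ring|].
  field. now apply Cminus_eq_contra.
Qed.

(** * Integrals of complex-valued functions *)

Definition cex (F : R -> C) (a b : R) : Prop := ex_RInt (V := C_R_NormedModule) F a b.
Definition cint (F : R -> C) (a b : R) : C := RInt (V := C_R_CompleteNormedModule) F a b.

Lemma cint_correct (F : R -> C) (a b : R) :
  cex F a b -> is_RInt (V := C_R_NormedModule) F a b (cint F a b).
Proof. exact (RInt_correct (V := C_R_CompleteNormedModule) F a b). Qed.

Lemma cint_unique (F : R -> C) (a b : R) (l : C) :
  is_RInt (V := C_R_NormedModule) F a b l -> cint F a b = l.
Proof. exact (is_RInt_unique (V := C_R_CompleteNormedModule) F a b l). Qed.

Lemma norm_R_Cmod (z : C) : norm (V := C_R_NormedModule) z = Cmod z.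
Proof.
unfold norm; simpl. unfold prod_norm, Cmod. unfold norm; simpl. unfold abs; simpl.
f_equal. rewrite !Rmult_1_r, <- !Rabs_mult, !Rabs_pos_eq; try reflexivity; apply Rle_0_sqr.
Qed.

(** The integral is linear over the reals only, so a complex factor is
    distributed over the components. *)
Lemma is_cint_scal (F : R -> C) (a b : R) (c l : C) :
  is_RInt (V := C_R_NormedModule) F a b l ->
  is_RInt (V := C_R_NormedModule) (fun x => c * F x)%C a b (c * l)%C.
Proof.
intros H.
pose proof (is_RInt_fct_extend_fst (U := R_NormedModule) (V := R_NormedModule) _ _ _ _ H) as H1.
pose proof (is_RInt_fct_extend_snd (U := R_NormedModule) (V := R_NormedModule) _ _ _ _ H) as H2.
apply (is_RInt_fct_extend_pair (U := R_NormedModule) (V := R_NormedModule)).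
- exact (is_RInt_minus _ _ _ _ _ _ (is_RInt_scal _ _ _ (fst c) _ H1)
    (is_RInt_scal _ _ _ (snd c) _ H2)).
- exact (is_RInt_plus _ _ _ _ _ _ (is_RInt_scal _ _ _ (fst c) _ H2)
    (is_RInt_scal _ _ _ (snd c) _ H1)).
Qed.

Lemma cex_scal (F : R -> C) (a b : R) (c : C) :
  cex F a b -> cex (fun x => c * F x)%C a b.
Proof. intros [l H]. exists (c * l)%C. now apply is_cint_scal. Qed.

Lemma cint_scal (F : R -> C) (a b : R) (c : C) :
  cex F a b -> cint (fun x => c * F x)%C a b = (c * cint F a b)%C.
Proof. intros H. apply cint_unique, is_cint_scal, cint_correct, H. Qed.

Lemma cex_minus (F G : R -> C) (a b : R) :
  cex F a b -> cex G a b -> cex (fun x => F x - G x)%C a b.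
Proof. exact (ex_RInt_minus (V := C_R_NormedModule) F G a b). Qed.

Lemma cint_minus (F G : R -> C) (a b : R) :
  cex F a b -> cex G a b -> cint (fun x => F x - G x)%C a b = (cint F a b - cint G a b)%C.
Proof. exact (RInt_minus (V := C_R_CompleteNormedModule) F G a b). Qed.

Lemma cint_Chasles (F : R -> C) (a b c : R) :
  cex F a b -> cex F b c -> (cint F a b + cint F b c)%C = cint F a c.
Proof. exact (RInt_Chasles (V := C_R_CompleteNormedModule) F a b c). Qed.

Lemma cint_ext (F G : R -> C) (a b : R) :
  a <= b -> (forall x, a < x < b -> F x = G x) -> cint F a b = cint G a b.
Proof.
intros Hab H. apply (RInt_ext (V := C_R_CompleteNormedModule)).
intros x. rewrite Rmin_left, Rmax_right by assumption. apply H.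
Qed.

Lemma cex_ext (F G : R -> C) (a b : R) :
  a <= b -> (forall x, a < x < b -> F x = G x) -> cex F a b -> cex G a b.
Proof.
intros Hab H. apply (ex_RInt_ext (V := C_R_NormedModule)).
intros x. rewrite Rmin_left, Rmax_right by assumption. apply H.
Qed.

Lemma cint_const (c : C) (a b : R) : cint (fun _ => c) a b = (RtoC (b - a) * c)%C.
Proof.
rewrite <- scal_R_Cmult. exact (RInt_const (V := C_R_CompleteNormedModule) a b c).
Qed.

Lemma cint_bound (F : R -> C) (a b M : R) :
  a <= b -> cex F a b -> (forall x, a <= x <= b -> Cmod (F x) <= M) ->
  Cmod (cint F a b) <= (b - a) * M.
Proof.
intros Hab HF HM. rewrite <- norm_R_Cmod.
apply (norm_RInt_le_const (V := C_R_NormedModule) F a b); [assumption | | now apply cint_correct].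
intros x Hx. rewrite norm_R_Cmod. now apply HM.
Qed.

Lemma cint_bound_fun (F : R -> C) (g : R -> R) (a b : R) :
  a <= b -> cex F a b -> ex_RInt g a b -> (forall x, a <= x <= b -> Cmod (F x) <= g x) ->
  Cmod (cint F a b) <= RInt g a b.
Proof.
intros Hab HF Hg HM. rewrite <- norm_R_Cmod.
apply (norm_RInt_le (V := C_R_NormedModule) F g a b); try assumption.
- intros x Hx. rewrite norm_R_Cmod. now apply HM.
- now apply cint_correct.
- now apply (RInt_correct (V := R_CompleteNormedModule)).
Qed.

Lemma cex_cont (F : R -> C) (a b : R) :
  a <= b -> (forall x, a <= x <= b -> Clim (locally x) F (F x)) -> cex F a b.
Proof.
intros Hab H. apply (ex_RInt_continuous (V := C_R_CompleteNormedModule)).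
intros x. rewrite Rmin_left, Rmax_right by assumption. intros Hx.
apply Clim_filterlim; [apply locally_filter|]. now apply H.
Qed.

Lemma cex_Chasles_1 (F : R -> C) (a b c : R) : a <= b <= c -> cex F a c -> cex F a b.
Proof. exact (ex_RInt_Chasles_1 (V := C_R_CompleteNormedModule) F a b c). Qed.

Lemma cex_Chasles_2 (F : R -> C) (a b c : R) : a <= b <= c -> cex F a c -> cex F b c.
Proof. exact (ex_RInt_Chasles_2 (V := C_R_CompleteNormedModule) F a b c). Qed.

(** * Goursat's theorem for rectangles *)

Lemma hline_lim (x y : R) :
  filterlim (fun t : R => (t, y) : C) (locally x) (nhds (x, y)).
Proof.
apply (Clim_filterlim (locally x)). intros eps He. exists (mkposreal _ He). intros t Ht.
change (Cmod ((t, y) - (x, y)) < eps).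
replace ((t, y) - (x, y))%C with (RtoC (t - x))
  by (unfold RtoC, Cminus, Cplus, Copp; simpl; f_equal; ring).
rewrite Cmod_R. exact Ht.
Qed.

Lemma vline_lim (x y : R) :
  filterlim (fun t : R => (x, t) : C) (locally y) (nhds (x, y)).
Proof.
apply (Clim_filterlim (locally y)). intros eps He. exists (mkposreal _ He). intros t Ht.
change (Cmod ((x, t) - (x, y)) < eps).
replace ((x, t) - (x, y))%C with (Ci * RtoC (t - y))%C
  by (unfold RtoC, Ci, Cmult, Cminus, Cplus, Copp; simpl; f_equal; ring).
rewrite Cmod_mult, Cmod_Ci, Cmod_R, Rmult_1_l. exact Ht.
Qed.

Lemma Ccont_hline (G : C -> C) (x y : R) :
  Ccont G (x, y) -> Clim (locally x) (fun t => G (t, y)) (G (x, y)).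
Proof. intros H. exact (Clim_comp _ _ _ G _ (hline_lim x y) H). Qed.

Lemma Ccont_vline (G : C -> C) (x y : R) :
  Ccont G (x, y) -> Clim (locally y) (fun t => G (x, t)) (G (x, y)).
Proof. intros H. exact (Clim_comp _ _ _ G _ (vline_lim x y) H). Qed.

(** The integral of [G z dz] counterclockwise along the boundary of
    [a, b] x [c, d]. *)
Definition rect_int (G : C -> C) (a b c d : R) : C :=
  (cint (fun x => G (x, c)) a b - cint (fun x => G (x, d)) a b
   + Ci * (cint (fun y => G (b, y)) c d - cint (fun y => G (a, y)) c d))%C.

Lemma cex_hline (G : C -> C) (a b y : R) :
  a <= b -> (forall x, a <= x <= b -> Ccont G (x, y)) -> cex (fun x => G (x, y)) a b.
Proof. intros Hab H. apply cex_cont; [assumption|]. intros x Hx. apply Ccont_hline. now apply H. Qed.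

Lemma cex_vline (G : C -> C) (x c d : R) :
  c <= d -> (forall y, c <= y <= d -> Ccont G (x, y)) -> cex (fun y => G (x, y)) c d.
Proof. intros Hcd H. apply cex_cont; [assumption|]. intros y Hy. apply Ccont_vline. now apply H. Qed.

Lemma rect_int_quarters (G : C -> C) (a b c d m k : R) :
  a <= m <= b -> c <= k <= d ->
  (forall x y, a <= x <= b -> c <= y <= d -> Ccont G (x, y)) ->
  rect_int G a b c d =
    (rect_int G a m c k + rect_int G m b c k + rect_int G a m k d + rect_int G m b k d)%C.
Proof.
intros Hm Hk H. unfold rect_int.
assert (Hx : forall y, c <= y <= d ->
  cint (fun x => G (x, y)) a b = (cint (fun x => G (x, y)) a m + cint (fun x => G (x, y)) m b)%C).
{ intros y Hy. symmetry. apply cint_Chasles; apply cex_hline; try lra; intros; apply H; lra. }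
assert (Hy : forall x, a <= x <= b ->
  cint (fun y => G (x, y)) c d = (cint (fun y => G (x, y)) c k + cint (fun y => G (x, y)) k d)%C).
{ intros x Hx'. symmetry. apply cint_Chasles; apply cex_vline; try lra; intros; apply H; lra. }
rewrite !Hx, !Hy by lra. ring.
Qed.

(** An affine function contributes nothing: on opposite sides it differs by a
    constant, and the two constants cancel.  So only the distance of [G] to its
    affine approximation enters the bound. *)
Lemma rect_int_local (G : C -> C) (z0 A B : C) (eps a b c d : R) :
  a <= b -> c <= d ->
  (forall x y, a <= x <= b -> c <= y <= d -> Ccont G (x, y)) ->
  (forall x y, a <= x <= b -> c <= y <= d ->
     Cmod (G (x, y) - (A + B * ((x, y) - z0))) <= eps) ->
  Cmod (rect_int G a b c d) <= 2 * ((b - a) + (d - c)) * eps.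
Proof.
intros Hab Hcd Hc He.
assert (Hh : forall y, c <= y <= d -> cex (fun x => G (x, y)) a b).
{ intros; apply cex_hline; auto. }
assert (Hv : forall x, a <= x <= b -> cex (fun y => G (x, y)) c d).
{ intros; apply cex_vline; auto. }
assert (Kh : forall v : C, cex (fun _ => v) a b).
{ intros v. apply cex_cont; [assumption|]. intros; apply Clim_const. }
assert (Kv : forall v : C, cex (fun _ => v) c d).
{ intros v. apply cex_cont; [assumption|]. intros; apply Clim_const. }
assert (Hc1 := Hh c ltac:(lra)). assert (Hd1 := Hh d ltac:(lra)).
assert (Ha1 := Hv a ltac:(lra)). assert (Hb1 := Hv b ltac:(lra)).
set (vh := (B * (Ci * RtoC (c - d)))%C). set (vv := (B * RtoC (b - a))%C).
assert (E : rect_int G a b c d =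
  (cint (fun x => G (x, c) - G (x, d) - vh)%C a b
   + Ci * cint (fun y => G (b, y) - G (a, y) - vv)%C c d)%C).
{ rewrite (cint_minus (fun x => G (x, c) - G (x, d))%C (fun _ => vh)) by auto using cex_minus.
  rewrite (cint_minus (fun x => G (x, c)) (fun x => G (x, d))) by assumption.
  rewrite (cint_minus (fun y => G (b, y) - G (a, y))%C (fun _ => vv)) by auto using cex_minus.
  rewrite (cint_minus (fun y => G (b, y)) (fun y => G (a, y))) by assumption.
  rewrite !cint_const. unfold rect_int, vh, vv. rewrite !RtoC_minus. ring. }
rewrite E. clear E.
eapply Rle_trans; [apply Cmod_triangle|].
rewrite Cmod_mult, Cmod_Ci, Rmult_1_l.
replace (2 * (b - a + (d - c)) * eps) with ((b - a) * (2 * eps) + (d - c) * (2 * eps)) by ring.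
apply Rplus_le_compat; apply cint_bound; try assumption.
- auto using cex_minus.
- intros x Hx.
  replace (G (x, c) - G (x, d) - vh)%C with
    ((G (x, c) - (A + B * ((x, c) - z0))) - (G (x, d) - (A + B * ((x, d) - z0))))%C.
  + eapply Rle_trans; [apply Cmod_sub_le|].
    pose proof (He x c Hx). pose proof (He x d Hx). lra.
  + unfold vh. replace (Ci * RtoC (c - d))%C with ((x, c) - (x, d))%C; [ring|].
    unfold RtoC, Ci, Cmult, Cminus, Cplus, Copp; simpl; f_equal; ring.
- auto using cex_minus.
- intros y Hy.
  replace (G (b, y) - G (a, y) - vv)%C with
    ((G (b, y) - (A + B * ((b, y) - z0))) - (G (a, y) - (A + B * ((a, y) - z0))))%C.
  + eapply Rle_trans; [apply Cmod_sub_le|].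
    pose proof (He b y). pose proof (He a y). lra.
  + unfold vv. replace (RtoC (b - a))%C with ((b, y) - (a, y))%C; [ring|].
    unfold RtoC, Cminus, Cplus, Copp; simpl; f_equal; ring.
Qed.

Lemma pow_half_pos (k : nat) : 0 < (/ 2) ^ k.
Proof. apply pow_lt. lra. Qed.

Lemma pow_half_lim (w eps : R) : 0 < eps -> exists k, w * (/ 2) ^ k < eps.
Proof.
intros He.
destruct (pow_lt_1_zero (/ 2) ltac:(rewrite Rabs_pos_eq; lra) (eps / (1 + Rabs w)))
  as [k Hk].
{ apply Rdiv_lt_0_compat; [assumption|]. pose proof (Rabs_pos w); lra. }
exists k. specialize (Hk k (le_n k)).
pose proof (Rabs_pos w). pose proof (pow_half_pos k).
rewrite Rabs_pos_eq in Hk by lra.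
apply Rle_lt_trans with ((1 + Rabs w) * (/ 2) ^ k).
{ apply Rmult_le_compat_r; [lra|]. pose proof (Rle_abs w). lra. }
apply Rmult_lt_compat_l with (r := 1 + Rabs w) in Hk; [|lra].
replace ((1 + Rabs w) * (eps / (1 + Rabs w))) with eps in Hk by (field; lra). exact Hk.
Qed.

Lemma nested_point (u : nat -> R) (w : R) :
  0 <= w ->
  (forall k, u k <= u (S k) /\ u (S k) + w * (/ 2) ^ (S k) <= u k + w * (/ 2) ^ k) ->
  exists X, forall k, u k <= X <= u k + w * (/ 2) ^ k.
Proof.
intros Hw H.
assert (M1 : forall j k, u j <= u (j + k)%nat).
{ intros j k. induction k as [|k IH]; [rewrite Nat.add_0_r; lra|].
  rewrite Nat.add_succ_r. destruct (H (j + k)%nat). lra. }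
assert (M2 : forall j k, u (j + k)%nat + w * (/ 2) ^ (j + k) <= u j + w * (/ 2) ^ j).
{ intros j k. induction k as [|k IH]; [rewrite Nat.add_0_r; lra|].
  rewrite Nat.add_succ_r. destruct (H (j + k)%nat). lra. }
assert (P : forall k, 0 <= w * (/ 2) ^ k).
{ intros k. apply Rmult_le_pos; [assumption|]. apply Rlt_le, pow_half_pos. }
assert (M : forall j k, u j <= u k + w * (/ 2) ^ k).
{ intros j k. destruct (Nat.le_ge_cases j k) as [L|L].
  - replace k with (j + (k - j))%nat by lia. specialize (M1 j (k - j)%nat).
    specialize (P (j + (k - j))%nat). lra.
  - replace j with (k + (j - k))%nat by lia. specialize (M2 k (j - k)%nat).
    specialize (P (k + (j - k))%nat). lra. }
destruct (completeness (fun r => exists j, r = u j)) as [X [HX1 HX2]].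
- exists (u O + w * (/ 2) ^ 0). intros r [j ->]. apply M.
- exists (u O). now exists O.
- exists X. intros k. split.
  + apply HX1. now exists k.
  + apply HX2. intros r [j ->]. apply M.
Qed.

Section Bisection.
Variables (G : C -> C) (a c w h : R).

(** The [k]-th generation of rectangles has sides [w / 2^k] and [h / 2^k]; such
    a rectangle is determined by its lower left corner. *)
Definition cell (k : nat) (P : R * R) : C :=
  rect_int G (fst P) (fst P + w * (/ 2) ^ k) (snd P) (snd P + h * (/ 2) ^ k).

(** One of the four quarters carries at least a fourth of the integral; the
    comparisons are decidable, so it is selected by computation, and the last
    quarter is taken when the first three fail. *)
Definition next_corner (k : nat) (P : R * R) : R * R :=
  let w' := w * (/ 2) ^ (S k) in
  let h' := h * (/ 2) ^ (S k) in
  let t := Cmod (cell k P) / 4 in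
  let (x, y) := P in
  if Rle_dec t (Cmod (cell (S k) (x, y))) then (x, y)
  else if Rle_dec t (Cmod (cell (S k) (x + w', y))) then (x + w', y)
  else if Rle_dec t (Cmod (cell (S k) (x, y + h'))) then (x, y + h')
  else (x + w', y + h').

Fixpoint corner (k : nat) : R * R :=
  match k with O => (a, c) | S k => next_corner k (corner k) end.

Hypothesis (Hw : 0 <= w) (Hh : 0 <= h).

Lemma side_pos (k : nat) : 0 <= w * (/ 2) ^ k /\ 0 <= h * (/ 2) ^ k.
Proof. pose proof (pow_half_pos k). split; apply Rmult_le_pos; lra. Qed.

Lemma next_corner_x (k : nat) :
  fst (corner k) <= fst (corner (S k)) /\
  fst (corner (S k)) + w * (/ 2) ^ (S k) <= fst (corner k) + w * (/ 2) ^ k.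
Proof.
pose proof (proj1 (side_pos (S k))) as P.
assert (E : w * (/ 2) ^ k = 2 * (w * (/ 2) ^ (S k))) by (simpl; field).
rewrite E. simpl corner. unfold next_corner. destruct (corner k) as [x y].
repeat (case Rle_dec; intros _); cbn [fst]; lra.
Qed.

Lemma next_corner_y (k : nat) :
  snd (corner k) <= snd (corner (S k)) /\
  snd (corner (S k)) + h * (/ 2) ^ (S k) <= snd (corner k) + h * (/ 2) ^ k.
Proof.
pose proof (proj2 (side_pos (S k))) as P.
assert (E : h * (/ 2) ^ k = 2 * (h * (/ 2) ^ (S k))) by (simpl; field).
rewrite E. simpl corner. unfold next_corner. destruct (corner k) as [x y].
repeat (case Rle_dec; intros _); cbn [snd]; lra.
Qed.

Lemma corner_range (k : nat) :
  a <= fst (corner k) /\ fst (corner k) + w * (/ 2) ^ k <= a + w /\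
  c <= snd (corner k) /\ snd (corner k) + h * (/ 2) ^ k <= c + h.
Proof.
induction k as [|k IH]; [simpl; lra|].
pose proof (next_corner_x k). pose proof (next_corner_y k). lra.
Qed.

Hypothesis Hc : forall x y, a <= x <= a + w -> c <= y <= c + h -> Ccont G (x, y).

(** Were all four quarters below a fourth, the triangle inequality would be
    violated. *)
Lemma cell_large (k : nat) :
  Cmod (rect_int G a (a + w) c (c + h)) * (/ 4) ^ k <= Cmod (cell k (corner k)).
Proof.
induction k as [|k IH].
{ unfold cell; simpl. rewrite !Rmult_1_r. lra. }
apply Rle_trans with (Cmod (cell k (corner k)) / 4); [simpl; lra|].
clear IH. pose proof (corner_range k) as Hr. pose proof (side_pos (S k)) as P.
simpl corner. unfold next_corner. destruct (corner k) as [x y]. simpl in Hr.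
set (w' := w * (/ 2) ^ (S k)) in *. set (h' := h * (/ 2) ^ (S k)) in *.
assert (Ew : w * (/ 2) ^ k = w' + w') by (unfold w'; simpl; field).
assert (Eh : h * (/ 2) ^ k = h' + h') by (unfold h'; simpl; field).
rewrite Ew, Eh in Hr.
assert (E : cell k (x, y) = (cell (S k) (x, y) + cell (S k) (x + w', y)%R
  + cell (S k) (x, y + h')%R + cell (S k) (x + w', y + h')%R)%C).
{ unfold cell; cbn [fst snd]. rewrite Ew, Eh. fold w' h'.
  rewrite (rect_int_quarters G _ _ _ _ (x + w') (y + h')) by (try lra; intros; apply Hc; lra).
  now rewrite !Rplus_assoc. }
do 3 (case Rle_dec; [intros; assumption | intros ?]).
assert (Cmod (cell k (x, y)) <= Cmod (cell (S k) (x, y)) + Cmod (cell (S k) (x + w', y))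
  + Cmod (cell (S k) (x, y + h')) + Cmod (cell (S k) (x + w', y + h'))).
{ rewrite E. eapply Rle_trans; [apply Cmod_triangle|]. apply Rplus_le_compat_r.
  eapply Rle_trans; [apply Cmod_triangle|]. apply Rplus_le_compat_r. apply Cmod_triangle. }
lra.
Qed.

End Bisection.

(** The integrals over the nested rectangles decrease at most like [4^(-k)],
    while differentiability at their common point makes them [o (4^(-k))]. *)
Theorem Goursat (G : C -> C) (a b c d : R) :
  a <= b -> c <= d ->
  (forall x y, a <= x <= b -> c <= y <= d -> Cdiff G (x, y)) ->
  rect_int G a b c d = RtoC 0.
Proof.
intros Hab Hcd H.
set (w := b - a). set (h := d - c).
assert (Hw : 0 <= w) by (unfold w; lra). assert (Hh : 0 <= h) by (unfold h; lra).
assert (Eb : b = a + w) by (unfold w; ring). assert (Ed : d = c + h) by (unfold h; ring).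
rewrite Eb, Ed in *. clear Eb Ed Hab Hcd.
assert (Hc : forall x y, a <= x <= a + w -> c <= y <= c + h -> Ccont G (x, y)).
{ intros; apply Cdiff_cont; now apply H. }
apply Cmod_eq_0. apply Rle_antisym; [|apply Cmod_ge_0]. apply Rnot_lt_le. intros Hpos.
destruct (nested_point (fun k => fst (corner G a c w h k)) w Hw
  (next_corner_x G a c w h Hw Hh)) as [X HX].
destruct (nested_point (fun k => snd (corner G a c w h k)) h Hh
  (next_corner_y G a c w h Hw Hh)) as [Y HY].
assert (HX0 := HX O). assert (HY0 := HY O). simpl in HX0, HY0.
rewrite Rmult_1_r in HX0, HY0.
destruct (H X Y HX0 HY0) as [s [Hs HG]].
set (L := Cmod (rect_int G a (a + w) c (c + h))) in *.
set (q := (w + h) * (w + h)).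
assert (Hq : 0 <= q) by (unfold q; nra).
assert (He : 0 < L / (2 * q + 1)) by (apply Rdiv_lt_0_compat; lra).
set (eps := L / (2 * q + 1)) in *.
destruct (proj1 (nhds_Cmod _ _) (filter_and _ _ HG (Hs _ He))) as [r [Hr Hloc]].
destruct (pow_half_lim (w + h) r Hr) as [k Hk].
pose proof (cell_large G a c w h Hw Hh Hc k) as Hbig. fold L in Hbig.
pose proof (corner_range G a c w h Hw Hh k) as Hcor.
specialize (HX k). specialize (HY k).
pose proof (side_pos w h Hw Hh k) as Hside.
destruct (corner G a c w h k) as [x0 y0]. simpl in HX, HY, Hcor.
set (wk := w * (/ 2) ^ k) in *. set (hk := h * (/ 2) ^ k) in *.
assert (Hsum : (w + h) * (/ 2) ^ k = wk + hk) by (unfold wk, hk; ring).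
rewrite Hsum in Hk.
assert (Hsmall : Cmod (cell G w h k (x0, y0))
  <= 2 * ((x0 + wk - x0) + (y0 + hk - y0)) * (eps * (wk + hk))).
{ unfold cell; cbn [fst snd]. fold wk hk.
  apply (rect_int_local G (X, Y) (G (X, Y)) (s (X, Y))); try lra.
  - intros; apply Hc; lra.
  - intros x y Hx Hy.
    assert (Hd : Cmod ((x, y) - (X, Y)) <= wk + hk).
    { eapply Rle_trans; [apply Cmod_le_sum|]. simpl.
      apply Rplus_le_compat; apply Rabs_le; lra. }
    destruct (Hloc (x, y)) as [H1 H2]; [lra|].
    rewrite H1.
    replace (G (X, Y) + s (x, y) * ((x, y) - (X, Y)) -
      (G (X, Y) + s (X, Y) * ((x, y) - (X, Y))))%C
      with ((s (x, y) - s (X, Y)) * ((x, y) - (X, Y)))%C by ring.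
    rewrite Cmod_mult. apply Rmult_le_compat; try apply Cmod_ge_0; lra. }
replace (2 * ((x0 + wk - x0) + (y0 + hk - y0)) * (eps * (wk + hk)))
  with (2 * q * eps * (/ 4) ^ k) in Hsmall.
- assert (Hp : 0 < (/ 4) ^ k) by (apply pow_lt; lra).
  assert (L <= 2 * q * eps).
  { apply Rmult_le_reg_r with ((/ 4) ^ k); [assumption|]. lra. }
  assert (Eeps : L = (2 * q + 1) * eps) by (unfold eps; field; lra).
  lra.
- assert (E4 : (/ 4) ^ k = (/ 2) ^ k * (/ 2) ^ k).
  { rewrite <- Rpow_mult_distr. f_equal. field. }
  rewrite E4. unfold q, wk, hk. ring.
Qed.

(** * The complex exponential *)

Definition cexp (z : C) : C := (exp (fst z) * cos (snd z), exp (fst z) * sin (snd z)).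

Lemma cexp_plus (z w : C) : cexp (z + w) = (cexp z * cexp w)%C.
Proof.
unfold cexp, Cmult, Cplus; simpl. rewrite exp_plus, cos_plus, sin_plus. f_equal; ring.
Qed.

Lemma cexp_0 : cexp 0 = 1.
Proof. unfold cexp, RtoC; simpl. rewrite exp_0, cos_0, sin_0. f_equal; ring. Qed.

Lemma Cmod_cexp (z : C) : Cmod (cexp z) = exp (fst z).
Proof.
unfold cexp, Cmod; simpl.
replace (exp (fst z) * cos (snd z) * (exp (fst z) * cos (snd z) * 1) +
  exp (fst z) * sin (snd z) * (exp (fst z) * sin (snd z) * 1))
  with (exp (fst z) * exp (fst z)).
- apply sqrt_square. apply Rlt_le, exp_pos.
- pose proof (sin2_cos2 (snd z)) as H. unfold Rsqr in H.
  transitivity (exp (fst z) * exp (fst z) * (sin (snd z) * sin (snd z) + cos (snd z) * cos (snd z)));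
    [rewrite H|]; ring.
Qed.

(** The mean value inequality turns a bound on the derivative into one of the
    next order; iterating it yields the Taylor remainders below. *)
Lemma taylor_step (g g' : R -> R) (M : R) (k : nat) :
  0 <= M -> g 0 = 0 ->
  (forall t, Rabs t <= 1 -> is_derive g t (g' t)) ->
  (forall t, Rabs t <= 1 -> Rabs (g' t) <= M * Rabs t ^ k) ->
  forall t, Rabs t <= 1 -> Rabs (g t) <= M * Rabs t ^ S k.
Proof.
intros HM H0 Hd Hb t Ht.
replace (g t) with (g t - g 0) by (rewrite H0; ring).
replace (M * Rabs t ^ S k) with (M * Rabs t ^ k * Rabs (t - 0))
  by (rewrite Rminus_0_r; simpl; ring).
apply (bounded_variation g g').
intros u Hu. rewrite !Rminus_0_r in Hu. split; [apply Hd; lra|].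
eapply Rle_trans; [apply Hb; lra|].
apply Rmult_le_compat_l; [assumption|]. apply pow_incr. split; [apply Rabs_pos | exact Hu].
Qed.

Lemma exp_taylor2 (t : R) : Rabs t <= 1 -> Rabs (exp t - 1 - t - t ^ 2 / 2) <= 3 * Rabs t ^ 3.
Proof.
assert (B0 : forall t, Rabs t <= 1 -> Rabs (exp t) <= 3 * Rabs t ^ 0).
{ intros u Hu. apply Rabs_le_between in Hu. rewrite Rabs_pos_eq by (apply Rlt_le, exp_pos). simpl.
  pose proof exp_le_3. destruct (Rle_lt_or_eq_dec u 1) as [Hl| ->]; [lra| |lra].
  pose proof (exp_increasing u 1 Hl). lra. }
revert t. apply (taylor_step _ (fun t => exp t - 1 - t)); [lra | rewrite exp_0; lra | |].
{ intros u _. auto_derive; [trivial|]. field. }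
apply (taylor_step _ (fun t => exp t - 1)); [lra | rewrite exp_0; lra | |].
{ intros u _. auto_derive; [trivial|]. field. }
apply (taylor_step _ exp); [lra | rewrite exp_0; lra | |exact B0].
intros u _. auto_derive; [trivial|]. field.
Qed.

Lemma cos_taylor1 (t : R) : Rabs t <= 1 -> Rabs (cos t - 1) <= 1 * Rabs t ^ 2.
Proof.
revert t. apply (taylor_step _ (fun t => - sin t)); [lra | rewrite cos_0; lra | |].
{ intros u _. auto_derive; [trivial|]. field. }
apply (taylor_step _ (fun t => - cos t)); [lra | rewrite sin_0; lra | |].
{ intros u _. auto_derive; [trivial|]. field. }
intros u _. rewrite Rabs_Ropp. simpl. pose proof (COS_bound u). apply Rabs_le; lra.
Qed.

Lemma sin_taylor2 (t : R) : Rabs t <= 1 -> Rabs (sin t - t) <= 1 * Rabs t ^ 3.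
Proof.
revert t. apply (taylor_step _ (fun t => cos t - 1)); [lra | rewrite sin_0; lra | |apply cos_taylor1].
intros u _. auto_derive; [trivial|]. field.
Qed.

Lemma cos_taylor3 (t : R) : Rabs t <= 1 -> Rabs (cos t - 1 + t ^ 2 / 2) <= 1 * Rabs t ^ 4.
Proof.
revert t. apply (taylor_step _ (fun t => - (sin t - t))); [lra | rewrite cos_0; lra | |].
{ intros u _. auto_derive; [trivial|]. field. }
intros u Hu. rewrite Rabs_Ropp. now apply sin_taylor2.
Qed.

(** Order three is needed because [expq], which already divides by [u] once,
    must be differentiable at [0]. *)
Lemma cexp_taylor2 (w : C) : Cmod w <= 1 ->
  Cmod (cexp w - 1 - w - w * w / 2) <= 20 * Cmod w ^ 3.
Proof.
intros Hw. pose proof (Cmod_fst w) as Hx. pose proof (Cmod_snd w) as Hy.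
destruct w as [x y]. simpl fst in *. simpl snd in *.
set (r := Cmod (x, y)) in *.
pose proof (exp_taylor2 x ltac:(lra)) as H1.
pose proof (sin_taylor2 y ltac:(lra)) as H2.
pose proof (cos_taylor3 y ltac:(lra)) as H3.
set (e1 := exp x - 1 - x - x ^ 2 / 2) in *.
set (e2 := sin y - y) in *.
set (e3 := cos y - 1 + y ^ 2 / 2) in *.
pose proof (Rabs_pos x) as Px. pose proof (Rabs_pos y) as Py.
assert (R3 : 0 <= r ^ 3) by (apply pow_le; lra).
assert (X1 : Rabs e1 <= 3 * r ^ 3).
{ eapply Rle_trans; [exact H1|]. apply Rmult_le_compat_l; [lra|]. apply pow_incr; lra. }
assert (X2 : Rabs e2 <= r ^ 3).
{ eapply Rle_trans; [exact H2|]. rewrite Rmult_1_l. apply pow_incr; lra. }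
assert (Y3 : Rabs y ^ 3 <= r ^ 3) by (apply pow_incr; lra).
assert (X3 : Rabs e3 <= r ^ 3).
{ eapply Rle_trans; [exact H3|]. rewrite Rmult_1_l.
  replace (Rabs y ^ 4) with (Rabs y ^ 3 * Rabs y) by ring.
  assert (0 <= Rabs y ^ 3) by (apply pow_le; lra). nra. }
assert (XYY : Rabs (x * y * y) <= r ^ 3).
{ rewrite !Rabs_mult. replace (r ^ 3) with (r * r * r) by ring.
  repeat apply Rmult_le_compat; try lra. now apply Rmult_le_pos. }
assert (XXY : Rabs (x * x * y) <= r ^ 3).
{ rewrite !Rabs_mult. replace (r ^ 3) with (r * r * r) by ring.
  repeat apply Rmult_le_compat; try lra. now apply Rmult_le_pos. }
eapply Rle_trans; [apply Cmod_le_sum|].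
assert (Bx : Rabs x <= 1) by lra. assert (By : Rabs y <= 1) by lra.
apply Rabs_le_between in Bx, By.
apply Rabs_le_between in X1, X2, X3, XYY, XXY.
assert (Q1 : Rabs (1 + x + x ^ 2 / 2) <= 3) by (apply Rabs_le; nra).
assert (M : forall a b, Rabs a <= 3 -> - r ^ 3 <= b <= r ^ 3 -> - (3 * r ^ 3) <= a * b <= 3 * r ^ 3).
{ intros a b Ha Hb. apply Rabs_le_between. rewrite Rabs_mult.
  apply Rmult_le_compat; try apply Rabs_pos; [assumption|]. now apply Rabs_le. }
assert (M3 : forall a b, Rabs a <= 1 -> - (3 * r ^ 3) <= b <= 3 * r ^ 3 -> - (3 * r ^ 3) <= a * b <= 3 * r ^ 3).
{ intros a b Ha Hb. apply Rabs_le_between. rewrite Rabs_mult.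
  rewrite <- (Rmult_1_l (3 * r ^ 3)).
  apply Rmult_le_compat; try apply Rabs_pos; [assumption|]. now apply Rabs_le. }
assert (M1 : forall a b, Rabs a <= 1 -> - r ^ 3 <= b <= r ^ 3 -> - r ^ 3 <= a * b <= r ^ 3).
{ intros a b Ha Hb. apply Rabs_le_between. rewrite Rabs_mult.
  rewrite <- (Rmult_1_l (r ^ 3)).
  apply Rmult_le_compat; try apply Rabs_pos; [assumption|]. now apply Rabs_le. }
assert (Cy : Rabs (cos y) <= 1) by (pose proof (COS_bound y); apply Rabs_le; lra).
assert (Sy : Rabs (sin y) <= 1) by (pose proof (SIN_bound y); apply Rabs_le; lra).
assert (Bx' : Rabs x <= 1) by (apply Rabs_le; lra).
assert (Re1 : Rabs (fst (cexp (x, y) - 1 - (x, y) - (x, y) * (x, y) / 2)%C) <= 10 * r ^ 3).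
{ replace (fst (cexp (x, y) - 1 - (x, y) - (x, y) * (x, y) / 2)%C)
    with (cos y * e1 + (1 + x + x ^ 2 / 2) * e3 - (x * y * y) / 2 - x * (x * y * y) / 4).
  - (* [e1], [e2], [e3] are the remainders of exp, sin and cos. *)
    pose proof (M3 _ _ Cy X1). pose proof (M _ _ Q1 X3). pose proof (M1 _ _ Bx' XYY).
    apply Rabs_le. lra.
  - unfold cexp, e1, e3, Cminus, Cdiv, Cplus, Copp, Cmult, Cinv, RtoC; simpl. field. }
assert (Im1 : Rabs (snd (cexp (x, y) - 1 - (x, y) - (x, y) * (x, y) / 2)%C) <= 10 * r ^ 3).
{ replace (snd (cexp (x, y) - 1 - (x, y) - (x, y) * (x, y) / 2)%C)
    with (sin y * e1 + (1 + x + x ^ 2 / 2) * e2 + (x * x * y) / 2).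
  - pose proof (M3 _ _ Sy X1). pose proof (M _ _ Q1 X2).
    apply Rabs_le. lra.
  - unfold cexp, e1, e2, Cminus, Cdiv, Cplus, Copp, Cmult, Cinv, RtoC; simpl. field. }
lra.
Qed.

(** [(e^u - 1) / u] with its removable singularity filled in. *)
Definition expq (u : C) : C := if Ceq_dec u 0 then 1 else ((cexp u - 1) / u)%C.

Lemma expq_mult (u : C) : (expq u * u)%C = (cexp u - 1)%C.
Proof.
unfold expq. destruct (Ceq_dec u 0) as [->|n].
- rewrite cexp_0. ring.
- now field.
Qed.

Lemma expq_0 : expq 0 = 1.
Proof. unfold expq. destruct (Ceq_dec 0 0) as [_|n]; [reflexivity | now elim n]. Qed.

Lemma Cdiff_expq_0 : Cdiff expq 0.
Proof.
exists (fun u => if Ceq_dec u 0 then / 2 else (expq u - 1) / u)%C. split.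
- unfold Ccont. destruct (Ceq_dec 0 0) as [_|n]; [|now elim n].
  intros eps He. apply nhds_Cmod. exists (Rmin 1 (eps / 20)).
  split; [apply Rmin_pos; lra|]. intros u Hu.
  replace (u - 0)%C with u in Hu by ring.
  pose proof (Rmin_l 1 (eps / 20)). pose proof (Rmin_r 1 (eps / 20)).
  destruct (Ceq_dec u 0) as [Hu0|n].
  { replace (/ 2 - / 2)%C with (RtoC 0) by ring. now rewrite Cmod_0. }
  assert (E : ((expq u - 1) / u - / 2)%C = ((cexp u - 1 - u - u * u / 2) / (u * u))%C).
  { rewrite <- expq_mult. field. assumption. }
  rewrite E, Cmod_div by now apply Cmult_neq_0.
  assert (Hpos : 0 < Cmod u) by now apply Cmod_gt_0.
  rewrite Cmod_mult.
  apply Rle_lt_trans with (20 * Cmod u); [|lra].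
  apply Rmult_le_reg_r with (Cmod u * Cmod u); [now apply Rmult_lt_0_compat|].
  unfold Rdiv. rewrite Rmult_assoc, Rinv_l, Rmult_1_r by (apply Rgt_not_eq; now apply Rmult_lt_0_compat).
  replace (20 * Cmod u * (Cmod u * Cmod u)) with (20 * Cmod u ^ 3) by ring.
  apply cexp_taylor2. lra.
- apply filter_forall. intros u. rewrite expq_0.
  destruct (Ceq_dec u 0) as [->|n]; [rewrite expq_0; ring | field; assumption].
Qed.

(** By the addition formula only the behaviour of [expq] at [0] matters. *)
Lemma Cdiff_cexp (z : C) : Cdiff cexp z.
Proof.
apply (Cdiff_ext_loc (fun w => cexp z * (1 + expq (w - z) * (w - z)))%C).
{ apply filter_forall. intros w. rewrite expq_mult.
  replace (1 + (cexp (w - z) - 1))%C with (cexp (w - z)) by ring.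
  rewrite <- cexp_plus. f_equal. ring. }
assert (Ds : Cdiff (fun w => w - z)%C z) by (apply Cdiff_minus; [apply Cdiff_id | apply Cdiff_const]).
apply Cdiff_mult; [apply Cdiff_const|]. apply Cdiff_plus; [apply Cdiff_const|].
apply Cdiff_mult; [|exact Ds].
apply (Cdiff_comp expq (fun w => w - z)%C); [exact Ds|].
replace (z - z)%C with (RtoC 0) by ring. exact Cdiff_expq_0.
Qed.

(** * The kernel and its residues *)

Section Kernel.
Variable p : R.
Hypothesis p_pos : 0 < p.

(** [turn z = e^(2 pi i z)]; [ckernel] is the function [h = N / D] of the
    introduction, with [knum] for [N] and [kden] for [D]. *)
Definition turn (z : C) : C := cexp (RtoC (2 * PI) * Ci * z).
Definition knum (z : C) : C := ((RtoC p + Ci * z) * turn z)%C.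
Definition kden (z : C) : C := (RtoC p - Ci * z - knum z)%C.
Definition ckernel (z : C) : C := (knum z / kden z)%C.

Lemma Cdiff_turn (z : C) : Cdiff turn z.
Proof.
apply (Cdiff_comp cexp (fun z => RtoC (2 * PI) * Ci * z)%C); [|apply Cdiff_cexp].
apply Cdiff_mult; [apply Cdiff_const | apply Cdiff_id].
Qed.

Lemma Cdiff_knum (z : C) : Cdiff knum z.
Proof.
apply Cdiff_mult; [|apply Cdiff_turn]. apply Cdiff_plus; [apply Cdiff_const|].
apply Cdiff_mult; [apply Cdiff_const | apply Cdiff_id].
Qed.

Lemma Cdiff_kden (z : C) : Cdiff kden z.
Proof.
apply Cdiff_minus; [|apply Cdiff_knum]. apply Cdiff_minus; [apply Cdiff_const|].
apply Cdiff_mult; [apply Cdiff_const | apply Cdiff_id].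
Qed.

Lemma Cdiff_ckernel (z : C) : kden z <> 0 -> Cdiff ckernel z.
Proof. intros H. apply Cdiff_div; [assumption | apply Cdiff_knum | apply Cdiff_kden]. Qed.

Definition weight (x : R) : R := (p ^ 2 + x ^ 2) / (p * (p + 1 / PI) + x ^ 2).
Definition residue (x : R) : C := (Ci * RtoC (weight x / (2 * PI)))%C.

(** The quotient of [kden z] by [z - l] at a zero [l] of [kden], obtained by
    writing [turn z] as [turn l * turn (z - l)] and dividing
    [turn (z - l) - 1] by [z - l]; see [kden_factor]. *)
Definition kden_quot (l : R) (z : C) : C :=
  (- (Ci * (1 + turn l * turn (z - l)))
   - RtoC (2 * PI) * Ci * (RtoC p - Ci * l) * expq (RtoC (2 * PI) * Ci * (z - l)))%C.

Lemma Cdiff_kden_quot (l : R) : Cdiff (kden_quot l) l.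
Proof.
assert (Ds : Cdiff (fun z => z - l)%C l) by (apply Cdiff_minus; [apply Cdiff_id | apply Cdiff_const]).
apply Cdiff_minus.
- apply Cdiff_opp. apply Cdiff_mult; [apply Cdiff_const|].
  apply Cdiff_plus; [apply Cdiff_const|]. apply Cdiff_mult; [apply Cdiff_const|].
  apply (Cdiff_comp turn (fun z => z - l)%C); [exact Ds | apply Cdiff_turn].
- apply Cdiff_mult; [apply Cdiff_const|].
  apply (Cdiff_comp expq (fun z => RtoC (2 * PI) * Ci * (z - l))%C).
  + apply Cdiff_mult; [apply Cdiff_const | exact Ds].
  + replace (RtoC (2 * PI) * Ci * (l - l))%C with (RtoC 0) by ring. exact Cdiff_expq_0.
Qed.

Lemma turn_plus (z w : C) : turn (z + w) = (turn z * turn w)%C.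
Proof. unfold turn. rewrite <- cexp_plus. f_equal. ring. Qed.

Lemma turn_0 : turn 0 = 1.
Proof. unfold turn. rewrite Cmult_0_r. apply cexp_0. Qed.

Lemma Ci_sqr : (Ci * Ci)%C = (- (1))%C.
Proof. unfold Ci, Cmult, RtoC, Copp; simpl. f_equal; ring. Qed.

Lemma kden_factor (l : R) (z : C) :
  kden l = 0 -> kden z = ((z - l) * kden_quot l z)%C.
Proof.
intros H.
assert (Hn : knum l = (RtoC p - Ci * l)%C).
{ unfold kden in H. apply Ceq_minus. rewrite <- Copp_minus_distr, H. ring. }
unfold knum in Hn.
assert (E := expq_mult (RtoC (2 * PI) * Ci * (z - l))). fold (turn (z - l)) in E.
unfold kden, knum. replace (turn z) with (turn l * turn (z - l))%C
  by (rewrite <- turn_plus; f_equal; ring).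
unfold kden_quot.
replace ((z - l) * (- (Ci * (1 + turn l * turn (z - l))) -
  RtoC (2 * PI) * Ci * (RtoC p - Ci * l) * expq (RtoC (2 * PI) * Ci * (z - l))))%C
  with (- (Ci * (z - l) * (1 + turn l * turn (z - l)))
    - (RtoC p - Ci * l) * (expq (RtoC (2 * PI) * Ci * (z - l)) * (RtoC (2 * PI) * Ci * (z - l))))%C
  by ring.
rewrite E, <- Hn. 
replace (RtoC p - Ci * z)%C with ((RtoC p - Ci * l) - Ci * (z - l))%C by ring.
rewrite <- Hn. ring.
Qed.

Lemma weight_den_pos (x : R) : 0 < p * (p + 1 / PI) + x ^ 2.
Proof.
pose proof PI_RGT_0. assert (0 < 1 / PI) by (apply Rdiv_lt_0_compat; lra).
assert (0 < p * (p + 1 / PI)) by (apply Rmult_lt_0_compat; lra).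
pose proof (pow2_ge_0 x). lra.
Qed.

(** At a zero, [turn l = (p - i l) / (p + i l)]; after multiplication by
    [p + i l] everything becomes a polynomial in [l], and
    [|p + i l|^2 = p^2 + l^2] produces the weight. *)
Lemma kden_quot_residue (l : R) :
  kden l = 0 -> kden_quot l l <> 0 /\ (knum l / kden_quot l l)%C = residue l.
Proof.
intros H.
assert (Hn : knum l = (RtoC p - Ci * l)%C).
{ unfold kden in H. apply Ceq_minus. rewrite <- Copp_minus_distr, H. ring. }
pose proof PI_RGT_0 as HPI. pose proof (weight_den_pos l) as Hw.
set (k := 2 * PI * (p * (p + 1 / PI) + l ^ 2)).
assert (Hk : 0 < k) by (unfold k; apply Rmult_lt_0_compat; lra).
assert (HP : (RtoC p + Ci * l)%C <> 0).
{ intros E. assert (E1 := f_equal fst E). unfold RtoC, Ci, Cplus, Cmult in E1; simpl in E1. lra. }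
assert (Hq : (kden_quot l l * (RtoC p + Ci * l))%C = (- Ci * RtoC k)%C).
{ unfold kden_quot. replace (l - l)%C with (RtoC 0) by ring.
  rewrite Cmult_0_r, expq_0, turn_0. unfold knum in Hn.
  replace ((- (Ci * (1 + turn l * 1)) - RtoC (2 * PI) * Ci * (RtoC p - Ci * l) * 1) * (RtoC p + Ci * l))%C
   with (- (Ci * ((RtoC p + Ci * l) + (RtoC p + Ci * l) * turn l)) -
     RtoC (2 * PI) * Ci * (RtoC p * RtoC p - Ci * Ci * (RtoC l * RtoC l)))%C by ring.
  rewrite Hn, Ci_sqr. unfold k.
  replace (2 * PI * (p * (p + 1 / PI) + l ^ 2)) with (2 * p + 2 * PI * (p * p + l * l)) by (field; lra).
  rewrite !RtoC_plus, !RtoC_mult, !RtoC_plus, !RtoC_mult. ring. }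
assert (Hkc : RtoC k <> 0) by (intros E; apply RtoC_inj in E; lra).
assert (H0 : kden_quot l l <> 0).
{ intros E. rewrite E in Hq. symmetry in Hq. rewrite Cmult_0_l in Hq. revert Hq.
  apply Cmult_neq_0; [|assumption]. intros E1. apply Ci_nz.
  replace Ci with (- - Ci)%C by ring. rewrite E1. ring. }
split; [assumption|].
replace (kden_quot l l) with (- Ci * RtoC k / (RtoC p + Ci * l))%C
  by (rewrite <- Hq; field; assumption).
rewrite Hn.
replace ((RtoC p - Ci * l) / (- Ci * RtoC k / (RtoC p + Ci * l)))%C
  with ((RtoC p * RtoC p - Ci * Ci * (RtoC l * RtoC l)) / (- (Ci * RtoC k)))%C.
2:{ field. repeat split; try assumption. apply Ci_nz. }
rewrite Ci_sqr. unfold residue.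
replace (weight l / (2 * PI)) with ((p * p + l * l) / k)
  by (unfold weight, k; set (W := p * (p + 1 / PI) + l ^ 2) in *; field; split; lra).
rewrite RtoC_div, RtoC_plus, !RtoC_mult by lra.
transitivity (- / Ci * ((RtoC p * RtoC p + RtoC l * RtoC l) / RtoC k))%C.
- field. split; [assumption | apply Ci_nz].
- rewrite Ci_inv. ring.
Qed.
End Kernel.

(** * Poles, size and symmetry of the kernel *)

Definition nhds' (z : C) : (C -> Prop) -> Prop := within (fun w => w <> z) (nhds z).

#[local] Instance nhds'_filter (z : C) : Filter (nhds' z).
Proof. apply within_filter, nhds_filter. Qed.

Lemma nhds'_le (z : C) : filter_le (nhds' z) (nhds z).
Proof. apply filter_le_within. Qed.

Lemma nhds'_neq (z : C) (P : C -> Prop) :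
  nhds z (fun w => w <> z -> P w) -> nhds' z P.
Proof. trivial. Qed.

Section KernelTheory.
Variable p : R.
Hypothesis p_pos : 0 < p.

(** Near [l] the product [f * ckernel] is [phi z / (z - l)] with [phi]
    differentiable at [l], so removing [phi l / (z - l)] leaves the slope of
    [phi], which is continuous. *)
Lemma pole_limit (f : C -> C) (l : R) :
  Cdiff f l -> kden p l = 0 ->
  exists v, Clim (nhds' l) (fun z => f z * ckernel p z - residue p l * f l / (z - l))%C v.
Proof.
intros Hf Hl.
destruct (kden_quot_residue p p_pos l Hl) as [H0 Hres].
assert (Dphi : Cdiff (fun z => f z * knum p z / kden_quot p l z)%C l).
{ apply Cdiff_div; [assumption | | apply Cdiff_kden_quot]. apply Cdiff_mult; [assumption | apply Cdiff_knum]. }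
destruct Dphi as [s [Hs H]]. exists (s l).
apply (Clim_ext_loc s); [|apply Clim_le_filter with (1 := nhds'_le l); exact Hs].
apply nhds'_neq.
assert (Hq := Ccont_nonzero _ _ (Cdiff_cont _ _ (Cdiff_kden_quot p l)) H0).
generalize (filter_and _ _ H Hq). apply filter_imp. intros z [H1 H2] Hz.
assert (Hzl : (z - l)%C <> 0) by now apply Cminus_eq_contra.
unfold ckernel. rewrite (kden_factor p l z Hl), <- Hres.
transitivity ((f z * knum p z / kden_quot p l z - f l * knum p l / kden_quot p l l) / (z - l))%C.
- rewrite H1. field. now repeat split.
- field. now repeat split.
Qed.

Lemma Cmod_turn (x y : R) : Cmod (turn (x, y)) = exp (- (2 * PI * y)).
Proof.
unfold turn. rewrite Cmod_cexp. f_equal. unfold RtoC, Ci, Cmult; simpl. ring.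
Qed.

Lemma Cmod_lin_plus (x y : R) : Cmod (RtoC p + Ci * (x, y)) = sqrt ((p - y) ^ 2 + x ^ 2).
Proof. unfold Cmod, RtoC, Ci, Cplus, Cmult; simpl. f_equal. ring. Qed.

Lemma Cmod_lin_minus (x y : R) : Cmod (RtoC p - Ci * (x, y)) = sqrt ((p + y) ^ 2 + x ^ 2).
Proof. unfold Cmod, RtoC, Ci, Cplus, Cminus, Copp, Cmult; simpl. f_equal. ring. Qed.

Lemma sum_sqr_pos (a b : R) : 0 < a -> 0 < a ^ 2 + b ^ 2.
Proof. intros Ha. pose proof (pow2_ge_0 b). pose proof (pow_lt a 2 Ha). lra. Qed.

Lemma Cmod_knum_le (x y : R) : 0 <= y ->
  Cmod (knum p (x, y)) <= exp (- (2 * PI * y)) * Cmod (RtoC p - Ci * (x, y)).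
Proof.
intros Hy. unfold knum. rewrite Cmod_mult, Cmod_turn, Cmod_lin_plus, Cmod_lin_minus, Rmult_comm.
apply Rmult_le_compat_l; [apply Rlt_le, exp_pos|]. apply sqrt_le_1_alt. nra.
Qed.

Lemma exp_neg_lt_1 (y : R) : 0 < y -> exp (- (2 * PI * y)) < 1.
Proof.
intros Hy. rewrite <- exp_0. apply exp_increasing. pose proof PI_RGT_0. nra.
Qed.

(** The zeros of [kden] are real: off the axis the point [z] is strictly closer
    to one of [i p] and [- i p] than to the other, and the modulus of [turn z]
    tilts the balance in the same direction. *)
Lemma kden_nonreal (x y : R) : y <> 0 -> kden p (x, y) <> 0.
Proof.
intros Hy H.
assert (E : Cmod (knum p (x, y)) = Cmod (RtoC p - Ci * (x, y))).
{ f_equal. unfold kden in H. symmetry. now apply Ceq_minus. }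
destruct (Rtotal_order y 0) as [L|[L|L]]; [|contradiction|].
- unfold knum in E. rewrite Cmod_mult, Cmod_turn in E.
  assert (L1 : Cmod (RtoC p - Ci * (x, y)) <= Cmod (RtoC p + Ci * (x, y))).
  { rewrite Cmod_lin_plus, Cmod_lin_minus. apply sqrt_le_1_alt. nra. }
  assert (L2 : 0 < Cmod (RtoC p + Ci * (x, y))).
  { rewrite Cmod_lin_plus. apply sqrt_lt_R0. apply sum_sqr_pos. lra. }
  assert (L3 : 1 < exp (- (2 * PI * y))).
  { rewrite <- exp_0. apply exp_increasing. pose proof PI_RGT_0. nra. }
  nra.
- pose proof (Cmod_knum_le x y ltac:(lra)).
  assert (L2 : 0 < Cmod (RtoC p - Ci * (x, y))).
  { rewrite Cmod_lin_minus. apply sqrt_lt_R0. apply sum_sqr_pos. lra. }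
  pose proof (exp_neg_lt_1 y L). nra.
Qed.

Lemma kden_real (x : R) :
  kden p x = (RtoC (2 * (p * sin (PI * x) + x * cos (PI * x))) * (sin (PI * x), (- cos (PI * x))%R))%C.
Proof.
unfold kden, knum, turn, cexp, RtoC, Ci, Cmult, Cminus, Cplus, Copp; cbn [fst snd].
replace ((2 * PI * 0 - 0 * 1) * x - (2 * PI * 1 + 0 * 0) * 0) with 0 by ring.
replace ((2 * PI * 0 - 0 * 1) * 0 + (2 * PI * 1 + 0 * 0) * x) with (2 * (PI * x)) by ring.
rewrite exp_0, sin_2a, cos_2a.
pose proof (sin2_cos2 (PI * x)) as H. unfold Rsqr in H.
set (s := sin (PI * x)) in *. set (c := cos (PI * x)) in *.
f_equal.
- transitivity (p * (s * s + c * c) - (p * (c * c - s * s) - x * (2 * s * c))); [rewrite H|]; ring.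
- transitivity (- x * (s * s + c * c) - (p * (2 * s * c) + x * (c * c - s * s))); [rewrite H|]; ring.
Qed.

Lemma kden_real_zero (x : R) :
  kden p x = 0 <-> p * sin (PI * x) + x * cos (PI * x) = 0.
Proof.
rewrite kden_real. split; intros H.
- set (g := p * sin (PI * x) + x * cos (PI * x)) in *.
  assert (H1 := f_equal fst H). assert (H2 := f_equal snd H).
  unfold RtoC, Cmult in H1, H2; simpl in H1, H2.
  pose proof (sin2_cos2 (PI * x)) as H3. unfold Rsqr in H3. clearbody g.
  assert (H4 : g * sin (PI * x) = 0) by lra. assert (H5 : g * cos (PI * x) = 0) by lra.
  transitivity (g * (sin (PI * x) * sin (PI * x) + cos (PI * x) * cos (PI * x))).
  + rewrite H3. ring.
  + replace (g * (sin (PI * x) * sin (PI * x) + cos (PI * x) * cos (PI * x)))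
      with (g * sin (PI * x) * sin (PI * x) + g * cos (PI * x) * cos (PI * x)) by ring.
    rewrite H4, H5. ring.
- rewrite H, Rmult_0_r. apply Cmult_0_l.
Qed.

(** From [|N| <= E |p - i z|], with [E = e^(-2 pi y) <= 1/2] as soon as
    [1 <= y], it follows that [|p - i z| <= 2 |D|]. *)
Lemma ckernel_top (x y : R) : 1 <= y -> Cmod (ckernel p (x, y)) <= 2 * exp (- (2 * PI * y)).
Proof.
intros Hy. pose proof (kden_nonreal x y ltac:(lra)) as H0.
pose proof (Cmod_knum_le x y ltac:(lra)) as HN.
assert (HE : exp (- (2 * PI * y)) <= / 2).
{ rewrite exp_Ropp. apply Rinv_le_contravar; [lra|].
  pose proof PI2_3_2. pose proof (exp_ineq1_le (2 * PI * y)). nra. }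
pose proof (exp_pos (- (2 * PI * y))) as Pe.
set (E := exp (- (2 * PI * y))) in *.
unfold ckernel. rewrite Cmod_div by assumption.
assert (HD : Cmod (RtoC p - Ci * (x, y)) <= 2 * Cmod (kden p (x, y))).
{ pose proof (Cmod_triangle (kden p (x, y)) (knum p (x, y))) as HT.
  replace (kden p (x, y) + knum p (x, y))%C with (RtoC p - Ci * (x, y))%C in HT by (unfold kden; ring).
  pose proof (Cmod_ge_0 (RtoC p - Ci * (x, y))). nra. }
assert (Hpos : 0 < Cmod (kden p (x, y))) by now apply Cmod_gt_0.
apply Rmult_le_reg_r with (Cmod (kden p (x, y))); [assumption|].
unfold Rdiv. rewrite Rmult_assoc, Rinv_l by lra. nra.
Qed.

Lemma turn_INR (n : nat) (y : R) : turn (INR n, y) = RtoC (exp (- (2 * PI * y))).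
Proof.
unfold turn, cexp, RtoC, Ci, Cmult; cbn [fst snd].
replace ((2 * PI * 0 - 0 * 1) * INR n - (2 * PI * 1 + 0 * 0) * y) with (- (2 * PI * y)) by ring.
replace ((2 * PI * 0 - 0 * 1) * y + (2 * PI * 1 + 0 * 0) * INR n) with (0 + 2 * INR n * PI) by ring.
rewrite sin_period, cos_period, sin_0, cos_0. f_equal; ring.
Qed.

(** On [Re z = n] the value of [turn] is real, so both components of the
    denominator can be read off: they bound it below by [n] and by [y], hence
    [p + y + n <= (p + 2) |D|]. *)
Lemma ckernel_right (n : nat) (y : R) : (1 <= n)%nat -> 0 <= y ->
  kden p (INR n, y) <> 0 /\ Cmod (ckernel p (INR n, y)) <= (p + 2) * exp (- (2 * PI * y)).
Proof.
intros Hn Hy. apply (le_INR 1) in Hn. simpl in Hn.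
pose proof (Cmod_knum_le (INR n) y Hy) as HN.
pose proof (exp_pos (- (2 * PI * y))) as Pe.
assert (HE : exp (- (2 * PI * y)) <= 1).
{ destruct Hy as [Hy| <-]; [left; now apply exp_neg_lt_1|]. rewrite Rmult_0_r, Ropp_0, exp_0; lra. }
assert (Ed : kden p (INR n, y) = (p * (1 - exp (- (2 * PI * y))) + y * (1 + exp (- (2 * PI * y))),
  - (INR n * (1 + exp (- (2 * PI * y)))))).
{ unfold kden, knum. rewrite turn_INR. set (E := exp (- (2 * PI * y))).
  unfold RtoC, Ci, Cmult, Cminus, Cplus, Copp; simpl. f_equal; ring. }
set (E := exp (- (2 * PI * y))) in *.
assert (D1 : INR n <= Cmod (kden p (INR n, y))).
{ eapply Rle_trans; [|apply Cmod_snd]. rewrite Ed. cbn [snd]. rewrite Rabs_Ropp, Rabs_pos_eq; nra. }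
assert (D2 : y <= Cmod (kden p (INR n, y))).
{ eapply Rle_trans; [|apply Cmod_fst]. rewrite Ed. cbn [fst]. rewrite Rabs_pos_eq; nra. }
assert (Hpos : 0 < Cmod (kden p (INR n, y))) by lra.
split; [now apply Cmod_gt_0|].
assert (HP : Cmod (RtoC p - Ci * (INR n, y)) <= p + y + INR n).
{ eapply Rle_trans; [apply Cmod_le_sum|].
  unfold RtoC, Ci, Cmult, Cminus, Cplus, Copp; cbn [fst snd].
  apply Rplus_le_compat; apply Rabs_le; lra. }
unfold ckernel. rewrite Cmod_div by now apply Cmod_gt_0.
apply Rmult_le_reg_r with (Cmod (kden p (INR n, y))); [assumption|].
unfold Rdiv. rewrite Rmult_assoc, Rinv_l by lra. rewrite Rmult_1_r.
set (d := Cmod (kden p (INR n, y))) in *.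
assert (p + y + INR n <= (p + 2) * d) by nra.
nra.
Qed.

(** [turn (x, - y)] is the inverse of the conjugate of [turn (x, y)], so
    reflection exchanges the two terms of the denominator. *)
Lemma ckernel_reflect (x y : R) : kden p (x, y) <> 0 ->
  kden p (x, (- y)%R) <> 0 /\ (- (1) - ckernel p (x, (- y)%R))%C = Cconj (ckernel p (x, y)).
Proof.
intros H0.
assert (Et : (Cconj (turn (x, y)) * turn (x, (- y)%R))%C = 1).
{ unfold turn. replace (Cconj (cexp (RtoC (2 * PI) * Ci * (x, y))))
    with (cexp (- (RtoC (2 * PI) * Ci * (x, (- y)%R)))).
  - rewrite <- cexp_plus, Cplus_comm, Cplus_opp_r. apply cexp_0.
  - replace (RtoC (2 * PI) * Ci * (x, y))%C with ((- (2 * PI * y))%R, 2 * PI * x)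
      by (unfold RtoC, Ci, Cmult; simpl; f_equal; ring).
    replace (- (RtoC (2 * PI) * Ci * (x, (- y)%R)))%C with ((- (2 * PI * y))%R, (- (2 * PI * x))%R)
      by (unfold RtoC, Ci, Cmult, Copp; simpl; f_equal; ring).
    unfold cexp, Cconj; cbn [fst snd]. rewrite sin_neg, cos_neg. f_equal; ring. }
assert (Ez : Cconj (x, y) = (x, (- y)%R)) by reflexivity.
assert (Ei : Cconj Ci = (- Ci)%C) by (unfold Cconj, Ci, Copp; simpl; f_equal; ring).
assert (Er : forall r : R, Cconj (RtoC r) = RtoC r).
{ intros r. unfold Cconj, RtoC; simpl; f_equal; ring. }
assert (En : (Cconj (knum p (x, y)) * turn (x, (- y)%R))%C = (RtoC p - Ci * (x, (- y)%R))%C).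
{ unfold knum. rewrite Cmult_conj, Cplus_conj, Cmult_conj, Er, Ei, Ez.
  rewrite <- Cmult_assoc, Et. ring. }
assert (Ed : (Cconj (kden p (x, y)) * turn (x, (- y)%R))%C = (- kden p (x, (- y)%R))%C).
{ unfold kden. rewrite Cminus_conj.
  transitivity (Cconj (RtoC p - Ci * (x, y)) * turn (x, (- y)%R)
    - Cconj (knum p (x, y)) * turn (x, (- y)%R))%C; [ring|].
  rewrite En, Cminus_conj, Cmult_conj, Er, Ei, Ez. unfold knum. ring. }
assert (Ht : turn (x, (- y)%R) <> 0).
{ intros E. rewrite E, Cmult_0_r in Et. now apply C1_nz. }
assert (Hc : Cconj (kden p (x, y)) <> 0).
{ intros E. apply H0. rewrite <- (Cconj_conj (kden p (x, y))), E. apply Er. }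
assert (Hd : kden p (x, (- y)%R) <> 0).
{ intros E. assert (Z := Cmult_neq_0 _ _ Hc Ht). apply Z. rewrite Ed, E. ring. }
split; [assumption|].
unfold ckernel. rewrite Cdiv_conj by assumption.
transitivity (- (RtoC p - Ci * (x, (- y)%R)) / kden p (x, (- y)%R))%C.
- replace (RtoC p - Ci * (x, (- y)%R))%C
    with (kden p (x, (- y)%R) + knum p (x, (- y)%R))%C by (unfold kden; ring).
  field. exact Hd.
- rewrite <- En.
  replace (kden p (x, (- y)%R)) with (- (Cconj (kden p (x, y)) * turn (x, (- y)%R)))%C by (rewrite Ed; ring).
  field. now split.
Qed.

Lemma ckernel_imaginary (y : R) : 0 < y ->
  ckernel p (0, y) = RtoC (kernel p y).
Proof.
intros Hy. unfold ckernel, knum, kden. unfold knum.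
change (turn (0, y)) with (turn (INR 0, y)). rewrite turn_INR.
set (E := exp (- (2 * PI * y))).
assert (HE : exp (2 * PI * y) = / E) by (unfold E; rewrite exp_Ropp, Rinv_inv; reflexivity).
assert (PE : 0 < E) by apply exp_pos.
assert (LE : E < 1) by now apply exp_neg_lt_1.
unfold kernel. rewrite HE.
replace (RtoC p + Ci * (0%R, y))%C with (RtoC (p - y))
  by (unfold RtoC, Ci, Cplus, Cmult; simpl; f_equal; ring).
replace (RtoC p - Ci * (0%R, y))%C with (RtoC (p + y))
  by (unfold RtoC, Ci, Cminus, Cplus, Copp, Cmult; simpl; f_equal; ring).
assert (0 < p + y - (p - y) * E) by nra.
rewrite <- RtoC_mult, <- RtoC_minus, <- RtoC_div by lra.
f_equal. field. split; [lra|]. nra.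
Qed.

Lemma ckernel_imaginary_neg (y : R) : 0 < y ->
  (- (1) - ckernel p (0%R, (- y)%R))%C = RtoC (kernel p y).
Proof.
intros Hy. destruct (ckernel_reflect 0 y) as [_ ->]; [apply kden_nonreal; lra|].
rewrite ckernel_imaginary by assumption. unfold Cconj, RtoC; simpl; f_equal; ring.
Qed.

End KernelTheory.

(** * Zeros of the denominator on the real axis *)

Lemma sin_shift (k : nat) (t : R) : sin (t + INR k * PI) = (-1) ^ k * sin t.
Proof.
induction k as [|k IH].
- simpl. rewrite Rmult_0_l, Rplus_0_r. ring.
- rewrite S_INR. replace (t + (INR k + 1) * PI) with ((t + INR k * PI) + PI) by ring.
  rewrite neg_sin, IH. simpl. ring.
Qed.

Lemma cos_shift (k : nat) (t : R) : cos (t + INR k * PI) = (-1) ^ k * cos t.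
Proof.
induction k as [|k IH].
- simpl. rewrite Rmult_0_l, Rplus_0_r. ring.
- rewrite S_INR. replace (t + (INR k + 1) * PI) with ((t + INR k * PI) + PI) by ring.
  rewrite neg_cos, IH. simpl. ring.
Qed.

Lemma cos_left_half (j : nat) (x : R) :
  (1 <= j)%nat -> INR j - 1 / 2 < x < INR j -> exists c, c < 0 /\ cos (PI * x) = (-1) ^ (pred j) * c.
Proof.
intros Hj Hx. destruct j as [|k]; [lia|]. rewrite S_INR in Hx. simpl pred.
exists (cos (PI * (x - INR k))). split.
- pose proof PI_RGT_0. apply cos_lt_0; nra.
- rewrite <- cos_shift. f_equal. ring.
Qed.

Lemma sign_sqr (k : nat) : (-1) ^ k * (-1) ^ k = 1.
Proof. rewrite <- Rpow_mult_distr. replace (-1 * -1) with 1 by ring. apply pow1. Qed.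

Section Zeros.
Variables (p : R) (lambda : nat -> R).
Hypothesis p_pos : 0 < p.
Hypothesis lambda_root : forall j : nat, (1 <= j)%nat ->
  INR j - 1 / 2 < lambda j < INR j /\ tan (PI * lambda j) = - lambda j / p.

(** Index [0] is kept for the zero at the origin, which lies on the contour. *)
Definition pole (j : nat) : R := match j with O => 0 | S k => lambda (S k) end.

Lemma lambda_zero (j : nat) : (1 <= j)%nat ->
  p * sin (PI * lambda j) + lambda j * cos (PI * lambda j) = 0.
Proof.
intros Hj. destruct (lambda_root j Hj) as [Hx Ht].
destruct (cos_left_half j _ Hj Hx) as [c [Hc E]].
assert (H0 : cos (PI * lambda j) <> 0).
{ rewrite E. intros H. pose proof (sign_sqr (pred j)). nra. }
unfold tan in Ht.
replace (sin (PI * lambda j)) with (- lambda j / p * cos (PI * lambda j))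
  by (rewrite <- Ht; field; assumption).
field. lra.
Qed.

Lemma pole_zero (j : nat) : kden p (pole j) = 0.
Proof.
apply kden_real_zero. destruct j as [|k]; simpl.
- rewrite Rmult_0_r, sin_0. ring.
- apply lambda_zero. lia.
Qed.

Lemma pole_range (j : nat) : (1 <= j)%nat -> INR j - 1 / 2 < pole j < INR j.
Proof. intros Hj. destruct j as [|k]; [lia|]. now apply lambda_root. Qed.

Lemma pole_lt (i j : nat) : (i < j)%nat -> pole i < pole j.
Proof.
intros H. pose proof (pole_range j ltac:(lia)) as Hj.
destruct i as [|i].
- apply (le_INR 1) in H. simpl in *. lra.
- pose proof (pole_range (S i) ltac:(lia)) as Hi.
  apply (le_INR (S (S i))) in H. rewrite (S_INR (S i)) in H. lra.
Qed.

Lemma pole_inj (i j : nat) : pole i = pole j -> i = j.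
Proof.
intros H. destruct (Nat.lt_trichotomy i j) as [L|[L|L]]; [|assumption|];
  apply pole_lt in L; lra.
Qed.

(** On [k, k + 1/2] sine and cosine of [pi x] have the same sign and do not
    vanish together, so there is no zero except [0].  On [k + 1/2, k + 1] two
    zeros [x] and [l] satisfy
    [p sin (pi (x - l)) = (l - x) cos (pi x) cos (pi l)], where the product of
    the cosines is positive; the signs agree only if [x = l]. *)
Lemma zero_is_pole (n : nat) (x : R) :
  0 <= x <= INR n -> kden p x = 0 -> exists j, (j <= n)%nat /\ x = pole j.
Proof.
intros Hx Hz. apply kden_real_zero in Hz.
destruct (proj1 Hx) as [Hpos|<-]; [|exists O; split; [lia | reflexivity]].
destruct (nfloor_ex x (proj1 Hx)) as [k Hk].
set (t := x - INR k). assert (Ht : 0 <= t < 1) by (unfold t; lra).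
pose proof PI_RGT_0 as HPI.
destruct (Rle_or_lt t (1 / 2)) as [L|L].
- exfalso.
  assert (E : PI * x = PI * t + INR k * PI) by (unfold t; ring).
  rewrite E, sin_shift, cos_shift in Hz.
  assert (Hc : 0 <= cos (PI * t)) by (apply cos_ge_0; nra).
  assert (Hs : 0 <= sin (PI * t)) by (apply sin_ge_0; nra).
  assert (Hz' : p * sin (PI * t) + x * cos (PI * t) = 0).
  { pose proof (sign_sqr k) as Hsg.
    transitivity ((-1) ^ k * (p * ((-1) ^ k * sin (PI * t)) + x * ((-1) ^ k * cos (PI * t)))).
    - transitivity ((-1) ^ k * (-1) ^ k * (p * sin (PI * t) + x * cos (PI * t))); [rewrite Hsg|]; ring.
    - rewrite Hz. ring. }
  pose proof (sin2_cos2 (PI * t)) as H1. unfold Rsqr in H1.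
  assert (P1 : 0 <= p * sin (PI * t)) by (apply Rmult_le_pos; lra).
  assert (P2 : 0 <= x * cos (PI * t)) by (apply Rmult_le_pos; lra).
  assert (S0 : sin (PI * t) = 0).
  { apply Rmult_eq_reg_l with p; [rewrite Rmult_0_r|]; lra. }
  assert (C0 : cos (PI * t) = 0).
  { apply Rmult_eq_reg_l with x; [rewrite Rmult_0_r|]; lra. }
  rewrite S0, C0 in H1. lra.
- exists (S k). split.
  { apply INR_le. rewrite S_INR. 
    destruct (Nat.le_gt_cases n k) as [Hle|Hgt].
    - apply le_INR in Hle. unfold t in L. lra.
    - apply (le_INR (S k)) in Hgt. rewrite S_INR in Hgt. lra. }
  assert (Hx' : INR (S k) - 1 / 2 < x < INR (S k)) by (rewrite S_INR; unfold t in *; lra).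
  pose proof (pole_range (S k) ltac:(lia)) as Hl.
  pose proof (lambda_zero (S k) ltac:(lia)) as Hz2. change (lambda (S k)) with (pole (S k)) in Hz2.
  set (l := pole (S k)) in *.
  destruct (cos_left_half (S k) x ltac:(lia) Hx') as [c1 [Hc1 E1]].
  destruct (cos_left_half (S k) l ltac:(lia) Hl) as [c2 [Hc2 E2]].
  assert (Hcc : 0 < cos (PI * x) * cos (PI * l)).
  { rewrite E1, E2. replace ((-1) ^ pred (S k) * c1 * ((-1) ^ pred (S k) * c2))
      with ((-1) ^ pred (S k) * (-1) ^ pred (S k) * (c1 * c2)) by ring.
    rewrite sign_sqr, Rmult_1_l. now apply Rmult_neg_neg. }
  assert (Hid : p * sin (PI * (x - l)) = (l - x) * (cos (PI * x) * cos (PI * l))).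
  { rewrite Rmult_minus_distr_l, sin_minus.
    transitivity (cos (PI * l) * (p * sin (PI * x) + x * cos (PI * x))
      - cos (PI * x) * (p * sin (PI * l) + l * cos (PI * l))
      + (l - x) * (cos (PI * x) * cos (PI * l))); [ring|].
    rewrite Hz, Hz2. ring. }
  destruct (Rtotal_order x l) as [Hlt|[Heq|Hgt]]; [|assumption|]; exfalso.
  + assert (0 < sin (PI * (l - x))) by (apply sin_gt_0; nra).
    replace (PI * (x - l)) with (- (PI * (l - x))) in Hid by ring. rewrite sin_neg in Hid. nra.
  + assert (0 < sin (PI * (x - l))) by (apply sin_gt_0; nra). nra.
Qed.

End Zeros.

(** * Crossing the real axis *)

(** Compactness: a property that holds in a neighbourhood of each point of the
    segment holds in a strip around it. *)
Lemma segment_uniform (a b : R) (Q : R -> R -> Prop) :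
  (forall x, a <= x <= b -> exists d, 0 < d /\
     forall t e, Rabs (t - x) < d -> Rabs e < d -> Q t e) ->
  exists d, 0 < d /\ forall t e, a <= t <= b -> Rabs e < d -> Q t e.
Proof.
intros H.
assert (Hx : forall x, exists d : posreal, a <= x <= b ->
  forall t e, Rabs (t - x) < d -> Rabs e < d -> Q t e).
{ intros x. destruct (classic (a <= x <= b)) as [I|I].
  - destruct (H x I) as [d [Hd Hq]]. exists (mkposreal d Hd). intros _. exact Hq.
  - exists (mkposreal 1 Rlt_0_1). intros I'. contradiction. }
set (delta x := proj1_sig (constructive_indefinite_description _ (Hx x))).
destruct (compactness_value_1d a b delta) as [d Hd].
exists d. split; [apply cond_pos|]. intros t e Ht He.
apply NNPP. intros HQ. apply (Hd t Ht). intros [x [Ix [H1 H2]]]. apply HQ.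
apply (proj2_sig (constructive_indefinite_description _ (Hx x)) Ix); [exact H1|].
fold (delta x). lra.
Qed.

Lemma Cmod_pair_sub_lt (t e x d : R) :
  Rabs (t - x) < d / 2 -> Rabs e < d / 2 -> Cmod ((t, e) - (x, 0)) < d.
Proof.
intros H1 H2. eapply Rle_lt_trans; [apply Cmod_le_sum|].
unfold Cminus, Cplus, Copp; cbn [fst snd].
replace (e + - 0) with e by ring. change (t + - x) with (t - x). lra.
Qed.

(** Limits at the points of the segment suffice, the values there being
    arbitrary; this is what [pole_limit] provides at the poles. *)
Lemma no_jump (q : C -> C) (a b eps : R) : 0 < eps ->
  (forall x : R, a <= x <= b -> exists v, Clim (nhds' x) q v) ->
  exists d, 0 < d /\ forall x e, a <= x <= b -> Rabs e < d -> e <> 0 ->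
    Cmod (q (x, e) - q (x, (- e)%R)) < eps.
Proof.
intros He H.
destruct (segment_uniform a b (fun t e => e <> 0 -> Cmod (q (t, e) - q (t, (- e)%R)) < eps))
  as [d [Hd Hu]].
- intros x Hx. destruct (H x Hx) as [v Hv].
  destruct (proj1 (nhds_Cmod _ _) (Hv (eps / 2) ltac:(lra))) as [d [Hd Hq]].
  exists (d / 2). split; [lra|]. intros t e Ht Hte He0.
  assert (A1 : Cmod (q (t, e) - v) < eps / 2).
  { apply Hq; [now apply Cmod_pair_sub_lt|]. intros E. injection E. tauto. }
  assert (A2 : Cmod (q (t, (- e)%R) - v) < eps / 2).
  { apply Hq; [apply Cmod_pair_sub_lt; [assumption | now rewrite Rabs_Ropp]|].
    intros E. injection E. lra. }
  pose proof (Cmod_triangle_sub (q (t, e)) v (q (t, (- e)%R))).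
  rewrite (Cmod_sub_comm v) in H0. lra.
- exists d. split; [assumption|]. intros x e Hx He'. now apply Hu.
Qed.

Lemma uniform_below (f : C -> C) (a b eps : R) : 0 < eps ->
  (forall x : R, a <= x <= b -> Ccont f x) ->
  exists d, 0 < d /\ forall x e, a <= x <= b -> Rabs e < d ->
    Cmod (f (x, (- e)%R) - f x) < eps.
Proof.
intros He H.
destruct (segment_uniform a b (fun t e => Cmod (f (t, (- e)%R) - f t) < eps))
  as [d [Hd Hu]].
- intros x Hx.
  destruct (proj1 (nhds_Cmod _ _) (H x Hx (eps / 2) ltac:(lra))) as [d [Hd Hq]].
  exists (d / 2). split; [lra|]. intros t e Ht Hte.
  assert (A1 : Cmod (f (t, (- e)%R) - f x) < eps / 2).
  { apply Hq. apply Cmod_pair_sub_lt; [assumption | now rewrite Rabs_Ropp]. }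
  assert (A2 : Cmod (f t - f x) < eps / 2).
  { apply Hq. apply Cmod_pair_sub_lt; [assumption | rewrite Rabs_R0; lra]. }
  pose proof (Cmod_triangle_sub (f (t, (- e)%R)) (f x) (f t)).
  rewrite (Cmod_sub_comm (f x)) in H0. lra.
- exists d. split; [assumption|]. intros x e Hx He'. now apply Hu.
Qed.

(** The integrand equals [- 2 i e / ((x - m)^2 + e^2)], a Poisson kernel up to a
    constant factor. *)
Lemma pole_jump_integral (m e b : R) : 0 < e ->
  is_RInt (V := C_R_NormedModule)
    (fun x => / ((x, e) - RtoC m) - / ((x, (- e)%R) - RtoC m))%C 0 b
    (- (2 * Ci) * RtoC (atan ((b - m) / e) + atan (m / e)))%C.
Proof.
intros He.
apply (is_RInt_ext (V := C_R_NormedModule)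
  (fun x => - (2 * Ci) * RtoC (e / ((x - m) ^ 2 + e ^ 2)))%C).
{ intros x _.
  assert (0 < (x - m) ^ 2 + e ^ 2).
  { pose proof (pow2_ge_0 (x - m)). pose proof (pow_lt e 2 He). lra. }
  apply injective_projections; unfold Ci, Cinv, Cmult, Cminus, Cplus, Copp, RtoC; simpl;
   field; repeat split; nra. }
apply is_cint_scal.
apply (is_RInt_fct_extend_pair (U := R_NormedModule) (V := R_NormedModule)); simpl.
- replace (atan ((b - m) / e) + atan (m / e))
    with (minus (atan ((b - m) / e)) (atan ((0 - m) / e))).
  2:{ unfold minus, plus, opp; simpl. replace ((0 - m) / e) with (- (m / e)) by (field; lra).
      rewrite atan_opp. ring. }
  apply (is_RInt_derive (fun x => atan ((x - m) / e))).
  + intros x _. auto_derive; [trivial|].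
    assert (0 < (x - m) ^ 2 + e ^ 2).
    { pose proof (pow2_ge_0 (x - m)). pose proof (pow_lt e 2 He). lra. }
    field. repeat split; nra.
  + intros x _. apply (ex_derive_continuous (V := R_NormedModule)). auto_derive.
    pose proof (pow2_ge_0 (x - m)). pose proof (pow_lt e 2 He). simpl in *. lra.
- pose proof (is_RInt_const (V := R_NormedModule) 0 b 0) as H0.
  refine (eq_ind _ (fun v => is_RInt (V := R_NormedModule) (fun _ => 0) 0 b v) H0 _ _).
  exact (scal_zero_r (V := R_NormedModule) (b - 0)).
Qed.

Lemma atan_inv_lim (c : R) : 0 < c ->
  filterlim (fun e => atan (c / e)) (at_right 0) (locally (PI / 2)).
Proof.
intros Hc. apply filterlim_locally. intros eps.
set (r := Rmin eps (PI / 4)).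
pose proof PI_RGT_0 as HPI. pose proof (cond_pos eps) as He.
assert (Hr : 0 < r) by (apply Rmin_pos; lra).
pose proof (Rmin_l eps (PI / 4)) as L1. pose proof (Rmin_r eps (PI / 4)) as L2. fold r in L1, L2.
assert (HT : 0 < tan (PI / 2 - r)) by (apply tan_gt_0; lra).
assert (Hd : 0 < c / (tan (PI / 2 - r))) by now apply Rdiv_lt_0_compat.
exists (mkposreal _ Hd). intros e Hb He0.
assert (Hb' : Rabs (e - 0) < c / tan (PI / 2 - r)) by exact Hb.
rewrite Rminus_0_r, Rabs_pos_eq in Hb' by lra.
assert (L : PI / 2 - r < atan (c / e)).
{ rewrite <- (atan_tan (PI / 2 - r)) by lra. apply atan_increasing.
  apply Rmult_lt_reg_r with e; [assumption|]. unfold Rdiv at 2. rewrite Rmult_assoc, Rinv_l, Rmult_1_r by lra.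
  apply Rmult_lt_compat_l with (r := tan (PI / 2 - r)) in Hb'; [|assumption].
  replace (tan (PI / 2 - r) * (c / tan (PI / 2 - r))) with c in Hb' by (field; lra). exact Hb'. }
pose proof (atan_bound (c / e)).
change (Rabs (atan (c / e) - PI / 2) < eps). apply Rabs_def1; lra.
Qed.

(** * Integrals with varying end points *)

Lemma is_cint_sum (t : nat -> R -> C) (l : nat -> C) (a b : R) (n : nat) :
  (forall k, (k <= n)%nat -> is_RInt (V := C_R_NormedModule) (t k) a b (l k)) ->
  is_RInt (V := C_R_NormedModule) (fun x => sum_n (G := C_AbelianMonoid) (fun k => t k x) n) a b
    (sum_n (G := C_AbelianMonoid) l n).
Proof.
induction n as [|n IH]; intros H.
- rewrite sum_O. apply (is_RInt_ext (V := C_R_NormedModule) (t O)); [|now apply H].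
  intros x _. now rewrite sum_O.
- rewrite sum_Sn.
  apply (is_RInt_ext (V := C_R_NormedModule)
    (fun x => plus (sum_n (G := C_AbelianMonoid) (fun k => t k x) n) (t (S n) x))).
  + intros x _. now rewrite sum_Sn.
  + apply (is_RInt_plus (V := C_R_NormedModule)); [|now apply H].
    apply IH. intros k Hk. apply H. lia.
Qed.

Lemma sum_n_Cminus (a b : nat -> C) (n : nat) :
  sum_n (G := C_AbelianMonoid) (fun k => a k - b k)%C n =
  (sum_n (G := C_AbelianMonoid) a n - sum_n (G := C_AbelianMonoid) b n)%C.
Proof.
induction n as [|n IH]; [now rewrite !sum_O|].
rewrite !sum_Sn, IH. unfold plus; simpl. ring.
Qed.

Lemma cint_reflect (g : R -> C) (a b : R) :
  cex g (- b) (- a) -> cex (fun y => g (- y)%R) a b /\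
  cint g (- b) (- a) = cint (fun y => g (- y)%R) a b.
Proof.
intros H. apply cint_correct in H.
apply (is_RInt_swap (V := C_R_NormedModule)) in H.
apply (is_RInt_comp_opp (V := C_R_NormedModule)) in H.
apply (is_RInt_opp (V := C_R_NormedModule)) in H.
rewrite opp_opp in H.
assert (H' : is_RInt (V := C_R_NormedModule) (fun y => g (- y)%R) a b (cint g (- b) (- a))).
{ revert H. apply (is_RInt_ext (V := C_R_NormedModule)). intros x _. apply opp_opp. }
split; [eexists; exact H'|]. symmetry. now apply cint_unique.
Qed.

(** Extending [F] by the constant [L] on the left makes it continuous at [0]. *)
Lemma cex_right_limit (F : R -> C) (L : C) (b : R) : 0 <= b ->
  (forall x, 0 < x <= b -> Clim (locally x) F (F x)) -> Clim (at_right 0) F L -> cex F 0 b.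
Proof.
intros Hb Hc HL.
set (G := fun x => if Rle_dec x 0 then L else F x).
apply (cex_ext G); [assumption| |].
{ intros x Hx. unfold G. destruct (Rle_dec x 0); [lra | reflexivity]. }
apply cex_cont; [assumption|]. intros x Hx. unfold G at 2. destruct (Rle_dec x 0) as [H0|H0].
- replace x with 0 by lra. intros eps He. destruct (HL eps He) as [d Hd]. exists d.
  intros y Hy. unfold G. destruct (Rle_dec y 0) as [Hy0|Hy0].
  + replace (L - L)%C with (RtoC 0) by ring. now rewrite Cmod_0.
  + apply Hd; [assumption | lra].
- apply (Clim_ext_loc F); [|apply Hc; lra].
  assert (Hxp : 0 < x) by lra. exists (mkposreal x Hxp). intros y Hy.
  assert (Hy' : Rabs (y - x) < x) by exact Hy. apply Rabs_def2 in Hy'.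
  unfold G. destruct (Rle_dec y 0); [lra | reflexivity].
Qed.

Lemma cint_lower_lim (F : R -> C) (L : C) (b : R) : 0 < b ->
  cex F 0 b -> Clim (at_right 0) F L ->
  Clim (at_right 0) (fun d => cint F d b) (cint F 0 b).
Proof.
intros Hb HF HL eps He.
set (M := Cmod L + 1 + Cmod (F 0)).
pose proof (Cmod_ge_0 L). pose proof (Cmod_ge_0 (F 0)).
assert (HM : 0 < M) by (unfold M; lra).
destruct (HL 1 Rlt_0_1) as [d Hd].
assert (Hr : 0 < Rmin (Rmin d b) (eps / M)).
{ repeat apply Rmin_pos; try assumption; [apply cond_pos | now apply Rdiv_lt_0_compat]. }
exists (mkposreal _ Hr). intros y Hy Hy0.
assert (Hy' : Rabs (y - 0) < Rmin (Rmin d b) (eps / M)) by exact Hy.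
rewrite Rminus_0_r, Rabs_pos_eq in Hy' by lra.
pose proof (Rmin_l (Rmin d b) (eps / M)). pose proof (Rmin_r (Rmin d b) (eps / M)).
pose proof (Rmin_l d b). pose proof (Rmin_r d b).
assert (X1 : cex F 0 y) by (apply (cex_Chasles_1 F 0 y b); [lra | assumption]).
assert (X2 : cex F y b) by (apply (cex_Chasles_2 F 0 y b); [lra | assumption]).
rewrite <- (cint_Chasles F 0 y b X1 X2).
replace (cint F y b - (cint F 0 y + cint F y b))%C with (- cint F 0 y)%C by ring.
rewrite Cmod_opp. apply Rle_lt_trans with ((y - 0) * M).
- apply cint_bound; [lra | assumption|]. intros x Hx. unfold M.
  destruct (proj1 Hx) as [Hxp|<-]; [|lra].
  assert (Hx' : Cmod (F x - L) < 1).
  { apply Hd; [|assumption]. change (Rabs (x - 0) < d). rewrite Rminus_0_r, Rabs_pos_eq; lra. }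
  pose proof (Cmod_triangle (F x - L) L) as HT. replace (F x - L + L)%C with (F x) in HT by ring. lra.
- assert (X3 : y < eps / M) by lra. apply Rmult_lt_compat_r with (r := M) in X3; [|assumption].
  replace (eps / M * M) with eps in X3 by (field; lra). lra.
Qed.

Lemma at_right_pos (P : R -> Prop) (b : R) : 0 < b ->
  (forall d, 0 < d < b -> P d) -> at_right 0 P.
Proof.
intros Hb H. exists (mkposreal b Hb). intros y Hy Hy0. apply H.
assert (Hy' : Rabs (y - 0) < b) by exact Hy. rewrite Rminus_0_r, Rabs_pos_eq in Hy'; lra.
Qed.

(** Absolute convergence: the increments of the integral of [F] are bounded by
    those of the integral of [g], so they satisfy Cauchy's criterion. *)
Lemma cint_dominated (F : R -> C) (g : R -> R) (L : R) :
  (forall b, 0 <= b -> cex F 0 b) ->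
  (forall b, 0 <= b -> ex_RInt g 0 b) ->
  (forall x, 0 <= x -> Cmod (F x) <= g x) ->
  filterlim (fun b => RInt g 0 b) (Rbar_locally p_infty) (locally L) ->
  exists v, Clim (Rbar_locally p_infty) (fun b => cint F 0 b) v /\ Cmod v <= L.
Proof.
intros HF Hg Hle HL.
assert (Hinc : forall a b, 0 <= a <= b -> Cmod (cint F 0 b - cint F 0 a) <= RInt g 0 b - RInt g 0 a).
{ intros a b Hab.
  assert (F1 : cex F 0 a) by (apply HF; lra).
  assert (F2 : cex F a b) by (apply (cex_Chasles_2 F 0 a b); [lra | apply HF; lra]).
  assert (G1 : ex_RInt g 0 a) by (apply Hg; lra).
  assert (G2 : ex_RInt g a b).
  { apply (ex_RInt_Chasles_2 (V := R_CompleteNormedModule) g 0 a b); [lra | apply Hg; lra]. }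
  rewrite <- (cint_Chasles F 0 a b F1 F2).
  assert (EG : RInt g 0 a + RInt g a b = RInt g 0 b)
    by exact (RInt_Chasles (V := R_CompleteNormedModule) g 0 a b G1 G2).
  replace (cint F 0 a + cint F a b - cint F 0 a)%C with (cint F a b) by ring.
  apply Rle_trans with (RInt g a b); [|lra].
  apply cint_bound_fun; try assumption; [lra|]. intros x Hx. apply Hle. lra. }
assert (Hex : exists v : C, Clim (Rbar_locally p_infty) (fun b => cint F 0 b) v).
{ assert (Hc : exists v : C_R_CompleteNormedModule,
    filterlim (fun b => cint F 0 b) (Rbar_locally p_infty) (locally v)).
  2:{ destruct Hc as [v Hv]. exists v. apply Clim_filterlim; [typeclasses eauto | exact Hv]. }
  apply (proj1 (filterlim_locally_cauchy (U := C_R_CompleteNormedModule)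
    (F := Rbar_locally p_infty) (fun b => cint F 0 b))). intros eps. pose proof (cond_pos eps) as He. assert (He2 : 0 < eps / 2) by lra.
  destruct (proj1 (filterlim_locally _ _) HL (mkposreal _ He2)) as [M HM].
  exists (fun b => 0 <= b /\ M < b). split.
  { exists (Rmax 0 M). intros x Hx. pose proof (Rmax_l 0 M). pose proof (Rmax_r 0 M). lra. }
  assert (HM' : forall b, M < b -> Rabs (RInt g 0 b - L) < eps / 2) by exact HM.
  assert (K : forall a b, 0 <= a <= b -> M < a -> Cmod (cint F 0 b - cint F 0 a) < eps).
  { intros a b Hab Ha. eapply Rle_lt_trans; [apply Hinc; assumption|].
    pose proof (Rabs_def2 _ _ (HM' a Ha)). pose proof (Rabs_def2 _ _ (HM' b ltac:(lra))). lra. }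
  intros u w [Hu1 Hu2] [Hw1 Hw2]. apply ball_Cmod.
  destruct (Rle_or_lt u w); [apply K; lra|]. rewrite Cmod_sub_comm. apply K; lra. }
destruct Hex as [v Hv']. exists v. split; [exact Hv'|].
apply Rnot_lt_le. intros Hlt. assert (He : 0 < (Cmod v - L) / 2) by lra.
destruct (filter_ex _ (filter_and _ _ (Hv' _ He) (filter_and _ _
  (proj1 (filterlim_locally _ _) HL (mkposreal _ He)) (open_Rbar_gt' p_infty 0 I)))) as [b [B1 [B2 B3]]].
assert (B2' : Rabs (RInt g 0 b - L) < (Cmod v - L) / 2) by exact B2.
apply Rabs_def2 in B2'. simpl in B3.
pose proof (Hinc 0 b ltac:(lra)) as Hi.
assert (Z1 : cint F 0 0 = 0) by exact (RInt_point (V := C_R_CompleteNormedModule) 0 F).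
assert (Z2 : RInt g 0 0 = 0) by exact (RInt_point (V := R_CompleteNormedModule) 0 g).
rewrite Z1, Z2 in Hi. replace (cint F 0 b - 0)%C with (cint F 0 b) in Hi by ring.
pose proof (Cmod_triangle_sub v (cint F 0 b) 0) as HT.
replace (v - 0)%C with v in HT by ring. replace (cint F 0 b - 0)%C with (cint F 0 b) in HT by ring.
rewrite (Cmod_sub_comm v) in HT. lra.
Qed.

Lemma is_cint_gen (F : R -> C) (l : C) :
  (forall b, 0 < b -> cex F 0 b) ->
  Clim (Rbar_locally p_infty) (fun b => cint F 0 b) l ->
  is_RInt_gen (V := C_R_NormedModule) F (at_point 0) (Rbar_locally p_infty) l.
Proof.
intros HF Hl.
apply (filterlimi_lim_ext_loc (fun ab => cint F (fst ab) (snd ab))).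
- apply (Filter_prod _ _ _ (fun a => a = 0) (fun b => 0 < b)).
  + reflexivity.
  + exists 0. trivial.
  + intros a b -> Hb. apply cint_correct. now apply HF.
- apply (Clim_filterlim (filter_prod (at_point 0) (Rbar_locally p_infty))).
  intros eps He. apply (Filter_prod _ _ _ (fun a => a = 0) (fun b => Cmod (cint F 0 b - l) < eps)).
  + reflexivity.
  + exact (Hl eps He).
  + intros a b -> Hb. exact Hb.
Qed.

Lemma RInt_gen_0_infty (g : R -> R) :
  ex_RInt_gen (V := R_NormedModule) g (at_point 0) (Rbar_locally p_infty) ->
  exists L, (forall b, 0 <= b -> ex_RInt g 0 b) /\
    filterlim (fun b => RInt g 0 b) (Rbar_locally p_infty) (locally L).
Proof.
intros [L HL]. exists L.
assert (Hloc : forall eps : posreal, Rbar_locally p_infty (fun b =>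
  exists z, is_RInt g 0 b z /\ ball L eps z)).
{ intros eps. destruct (proj1 (filterlimi_locally _ _) HL eps) as [P Q HP HQ H].
  revert HQ. apply filter_imp. intros b Hb. exact (H 0 b HP Hb). }
split.
- intros b Hb. destruct (Hloc (mkposreal 1 Rlt_0_1)) as [M HM].
  destruct (HM (Rmax M b + 1)) as [z [Hz _]]; [pose proof (Rmax_l M b); lra|].
  apply (ex_RInt_Chasles_1 (V := R_CompleteNormedModule) g 0 b (Rmax M b + 1)).
  + pose proof (Rmax_r M b); lra.
  + now exists z.
- apply filterlim_locally. intros eps. generalize (Hloc eps). apply filter_imp.
  intros b [z [Hz Hb]]. now rewrite (is_RInt_unique (V := R_CompleteNormedModule) _ _ _ _ Hz).
Qed.

(** A two-sided improper integral may be computed along the symmetric intervals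
    [- b, b], which are then folded onto [0, b]. *)
Lemma RInt_gen_symmetric (g : R -> R) (L : R) :
  is_RInt_gen (V := R_NormedModule) g (Rbar_locally m_infty) (Rbar_locally p_infty) L ->
  (forall b, 0 <= b -> ex_RInt (fun y => g y + g (- y)) 0 b) /\
  filterlim (fun b => RInt (fun y => g y + g (- y)) 0 b) (Rbar_locally p_infty) (locally L).
Proof.
intros HL.
assert (Hloc : forall eps : posreal, Rbar_locally p_infty (fun b =>
  0 <= b /\ exists z, is_RInt g (- b) b z /\ ball L eps z)).
{ intros eps. destruct (proj1 (filterlimi_locally _ _) HL eps) as [P Q HP HQ H].
  apply filter_and; [exists 0; intros; lra|].
  assert (HP' : Rbar_locally p_infty (fun b => P (- b))).
  { destruct HP as [M HM]. exists (- M). intros b Hb. apply HM. lra. }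
  generalize (filter_and _ _ HP' HQ). apply filter_imp. intros b [H1 H2]. exact (H (- b) b H1 H2). }
assert (Hex : forall b, 0 <= b -> ex_RInt g (- b) 0 /\ ex_RInt g 0 b).
{ intros b Hb. destruct (Hloc (mkposreal 1 Rlt_0_1)) as [M HM].
  pose proof (Rmax_l M b). pose proof (Rmax_r M b).
  destruct (HM (Rmax M b + 1)) as [_ [z [Hz _]]]; [lra|].
  assert (Ez : ex_RInt g (- (Rmax M b + 1)) (Rmax M b + 1)) by now exists z.
  split.
  - apply (ex_RInt_Chasles_1 (V := R_CompleteNormedModule) g (- b) 0 (Rmax M b + 1)); [lra|].
    apply (ex_RInt_Chasles_2 (V := R_CompleteNormedModule) g (- (Rmax M b + 1))); [lra | assumption].
  - apply (ex_RInt_Chasles_1 (V := R_CompleteNormedModule) g 0 b (Rmax M b + 1)); [lra|].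
    apply (ex_RInt_Chasles_2 (V := R_CompleteNormedModule) g (- (Rmax M b + 1))); [lra | assumption]. }
assert (Hsum : forall b, 0 <= b ->
  is_RInt (fun y => g y + g (- y)) 0 b (RInt g 0 b + RInt g (- b) 0)).
{ intros b Hb. destruct (Hex b Hb) as [E1 E2].
  apply (is_RInt_plus (V := R_NormedModule)).
  - now apply (RInt_correct (V := R_CompleteNormedModule)).
  - apply (RInt_correct (V := R_CompleteNormedModule)) in E1.
    apply (is_RInt_swap (V := R_NormedModule)) in E1.
    rewrite <- Ropp_0 in E1 at 1.
    apply (is_RInt_comp_opp (V := R_NormedModule)) in E1.
    apply (is_RInt_opp (V := R_NormedModule)) in E1.
    rewrite opp_opp in E1. revert E1. apply (is_RInt_ext (V := R_NormedModule)).
    intros x _. apply (opp_opp (G := R_AbelianGroup)). }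
split.
- intros b Hb. eexists. now apply Hsum.
- apply filterlim_locally. intros eps. generalize (Hloc eps). apply filter_imp.
  intros b [Hb [z [Hz Hball]]].
  rewrite (is_RInt_unique (V := R_CompleteNormedModule) _ _ _ _ (Hsum b Hb)).
  destruct (Hex b Hb) as [E1 E2].
  assert (EG := RInt_Chasles (V := R_CompleteNormedModule) g (- b) 0 b E1 E2).
  rewrite (is_RInt_unique (V := R_CompleteNormedModule) _ _ _ _ Hz) in EG.
  unfold plus in EG; simpl in EG. rewrite Rplus_comm, EG. exact Hball.
Qed.

(** * The contour identity *)

Section Summation.
Variables (p : R) (lambda : nat -> R) (f : C -> C).
Hypothesis p_pos : 0 < p.
Hypothesis lambda_root : forall j : nat, (1 <= j)%nat ->
  INR j - 1 / 2 < lambda j < INR j /\ tan (PI * lambda j) = - lambda j / p.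
Hypothesis f_diff : forall z : C, 0 <= fst z -> Cdiff f z.

(** The integrands that decay in the upper and in the lower half-plane. *)
Definition f_up (z : C) : C := (f z * ckernel p z)%C.
Definition f_down (z : C) : C := (f z * (- (1) - ckernel p z))%C.
(** What the two rectangles contribute after subtraction: [axis] comes from the
    left sides, [side] from the right ones, [jump] and [below] from those facing
    the real axis, at distance [e] from it, and [caps] from the outer horizontal
    ones. *)
Definition axis (y : R) : C := ((f (0%R, y) - f (0%R, (- y)%R)) * RtoC (kernel p y))%C.
Definition side (n : nat) (y : R) : C := (f_up (INR n, y) - f_down (INR n, (- y)%R))%C.
Definition jump (e x : R) : C := (f_up (x, e) - f_up (x, (- e)%R))%C.
Definition below (e x : R) : C := f (x, (- e)%R).
Definition caps (n : nat) (y : R) : C :=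
  (cint (fun x => f_up (x, y)) 0 (INR n) + cint (fun x => f_down (x, (- y)%R)) 0 (INR n))%C.

Lemma Cdiff_f_up (x y : R) : 0 <= x -> kden p (x, y) <> 0 -> Cdiff f_up (x, y).
Proof. intros Hx H. apply Cdiff_mult; [now apply f_diff | now apply Cdiff_ckernel]. Qed.

Lemma Cdiff_f_down (x y : R) : 0 <= x -> kden p (x, y) <> 0 -> Cdiff f_down (x, y).
Proof.
intros Hx H. apply Cdiff_mult; [now apply f_diff|].
apply Cdiff_minus; [apply Cdiff_const | now apply Cdiff_ckernel].
Qed.

Lemma axis_eq (y : R) : 0 < y -> axis y = (f_up (0%R, y) - f_down (0%R, (- y)%R))%C.
Proof.
intros Hy. unfold axis, f_up, f_down.
rewrite ckernel_imaginary_neg, ckernel_imaginary by assumption. ring.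
Qed.

(** [Goursat] for [f_up] on [0, n] x [d, Y] minus [Goursat] for [f_down] on
    [0, n] x [-Y, -d].  As [f_down = - f - f_up], the difference of the inner
    sides is the jump of [f_up] minus the integral of [f]. *)
Lemma contour_identity (n : nat) (d Y : R) : (1 <= n)%nat -> 0 < d <= Y ->
  (Ci * cint axis d Y)%C =
  (cint (jump d) 0 (INR n) - cint (below d) 0 (INR n) - caps n Y + Ci * cint (side n) d Y)%C.
Proof.
intros Hn Hd.
assert (Hn0 := pos_INR n).
assert (DU : forall x y, 0 <= x -> y <> 0 -> Cdiff f_up (x, y)).
{ intros x y Hx Hy. apply Cdiff_f_up; [assumption | now apply kden_nonreal]. }
assert (DL : forall x y, 0 <= x -> y <> 0 -> Cdiff f_down (x, y)).
{ intros x y Hx Hy. apply Cdiff_f_down; [assumption | now apply kden_nonreal]. }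
assert (Hh : forall g : C -> C, forall y : R, (forall x, 0 <= x -> Cdiff g (x, y)) ->
  cex (fun x => g (x, y)) 0 (INR n)).
{ intros g y Hg. apply cex_hline; [assumption|]. intros x Hx. apply Cdiff_cont, Hg. lra. }
assert (Up := Goursat f_up 0 (INR n) d Y Hn0 ltac:(lra)
  ltac:(intros x y Hx Hy; apply DU; lra)).
assert (Lo := Goursat f_down 0 (INR n) (- Y) (- d) Hn0 ltac:(lra)
  ltac:(intros x y Hx Hy; apply DL; lra)).
unfold rect_int in Up, Lo.
assert (VU : forall x, 0 <= x -> cex (fun y => f_up (x, y)) d Y).
{ intros x Hx. apply cex_vline; [lra|]. intros y Hy. apply Cdiff_cont, DU; lra. }
assert (VL : forall x, 0 <= x -> cex (fun y => f_down (x, (- y)%R)) d Y /\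
  cint (fun y => f_down (x, y)) (- Y) (- d) = cint (fun y => f_down (x, (- y)%R)) d Y).
{ intros x Hx. apply (cint_reflect (fun y => f_down (x, y))).
  apply cex_vline; [lra|]. intros y Hy. apply Cdiff_cont, DL; lra. }
destruct (VL 0 ltac:(lra)) as [VL0 EL0]. destruct (VL (INR n) Hn0) as [VLn ELn].
rewrite EL0, ELn in Lo.
assert (EA : cint axis d Y =
  (cint (fun y => f_up (0%R, y)) d Y - cint (fun y => f_down (0%R, (- y)%R)) d Y)%C).
{ rewrite <- cint_minus; [|apply VU; lra | assumption].
  apply cint_ext; [lra|]. intros y Hy. apply axis_eq. lra. }
assert (ES : cint (side n) d Y =
  (cint (fun y => f_up (INR n, y)) d Y - cint (fun y => f_down (INR n, (- y)%R)) d Y)%C).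
{ apply cint_minus; [now apply VU | assumption]. }
assert (EJ : cint (jump d) 0 (INR n) =
  (cint (fun x => f_up (x, d)) 0 (INR n) - cint (fun x => f_up (x, (- d)%R)) 0 (INR n))%C).
{ apply cint_minus; apply Hh; intros x Hx; apply DU; lra. }
assert (EB : cint (fun x => f_down (x, (- d)%R)) 0 (INR n) =
  (- (1) * cint (below d) 0 (INR n) - cint (fun x => f_up (x, (- d)%R)) 0 (INR n))%C).
{ rewrite <- cint_scal, <- cint_minus.
  - apply cint_ext; [assumption|]. intros x Hx. unfold f_down, f_up, below. ring.
  - apply cex_scal. apply Hh. intros x Hx. apply f_diff. exact Hx.
  - apply Hh; intros x Hx; apply DU; lra.
  - apply Hh. intros x Hx. apply f_diff. exact Hx. }
rewrite EB in Lo. rewrite EA, ES, EJ. unfold caps.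
apply Ceq_minus.
match type of Up with ?u = _ => match type of Lo with ?l = _ =>
  transitivity (l - u)%C; [ring | rewrite Up, Lo; ring] end end.
Qed.

(** * The contribution of the poles *)

Definition res_at (j : nat) : C := (residue p (pole lambda j) * f (pole lambda j))%C.
Definition principal (n : nat) (z : C) : C :=
  sum_n (G := C_AbelianMonoid) (fun j => res_at j / (z - pole lambda j))%C n.
Definition regular (n : nat) (z : C) : C := (f_up z - principal n z)%C.

Lemma term_limit (j : nat) (x : R) : x <> pole lambda j ->
  Clim (nhds' x) (fun z => res_at j / (z - pole lambda j))%C (res_at j / (x - pole lambda j))%C.
Proof.
intros H. apply Clim_le_filter with (1 := nhds'_le x).
apply Clim_div.
- apply Cminus_eq_contra. intros E. now apply RtoC_inj in E.
- apply Clim_const.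
- apply Clim_minus; [apply Ccont_id | apply Clim_const].
Qed.

(** Used to set apart the one singular term in a sum of principal parts. *)
Definition omit (k : nat) (a : nat -> C) (j : nat) : C :=
  if Nat.eq_dec j k then RtoC 0 else a j.

Lemma sum_n_extract (k n : nat) (a : nat -> C) : (k <= n)%nat ->
  sum_n (G := C_AbelianMonoid) a n =
  (a k + sum_n (G := C_AbelianMonoid) (omit k a) n)%C.
Proof.
assert (Hlt : forall m, (m < k)%nat -> sum_n (G := C_AbelianMonoid) a m =
  sum_n (G := C_AbelianMonoid) (omit k a) m).
{ intros m Hm. apply sum_n_ext_loc. intros j Hj. unfold omit. destruct (Nat.eq_dec j k); [lia | reflexivity]. }
induction n as [|n IH]; intros Hk.
- assert (k = O) as -> by lia. rewrite !sum_O. unfold omit. destruct (Nat.eq_dec 0 0); [|lia]. symmetry. apply Cplus_0_r.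
- rewrite !sum_Sn. unfold omit at 2. destruct (Nat.eq_dec (S n) k) as [E|E].
  + rewrite <- Hlt by lia. rewrite <- E. unfold plus; simpl. ring.
  + rewrite IH by lia. unfold plus; simpl. ring.
Qed.

(** At a pole [pole_limit] handles the term of that pole, the others being
    continuous there; elsewhere on the segment everything is continuous. *)
Lemma regular_limit (n : nat) (x : R) : 0 <= x <= INR n ->
  exists v, Clim (nhds' x) (regular n) v.
Proof.
intros Hx.
destruct (Ceq_dec (kden p x) 0) as [Hz|Hz].
- destruct (zero_is_pole p lambda p_pos lambda_root n x Hx Hz) as [k [Hk ->]].
  destruct (pole_limit p p_pos f (pole lambda k)) as [v Hv]; [apply f_diff; simpl; lra | assumption |].
  set (t := fun z j => (res_at j / (z - pole lambda j))%C).
  exists (v - sum_n (G := C_AbelianMonoid) (omit k (t (RtoC (pole lambda k)))) n)%C.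
  apply (Clim_ext_loc (fun z => (f z * ckernel p z - residue p (pole lambda k) * f (pole lambda k) /
     (z - pole lambda k)) - sum_n (G := C_AbelianMonoid) (omit k (t z)) n)%C).
  + apply filter_forall. intros z. unfold regular, principal.
    change (fun j => res_at j / (z - pole lambda j))%C with (t z).
    rewrite (sum_n_extract k n (t z)) by assumption.
    change (t z k) with (residue p (pole lambda k) * f (pole lambda k) / (z - pole lambda k))%C.
    unfold f_up. ring.
  + apply Clim_minus; [exact Hv|]. apply Clim_sum. intros j Hj. unfold omit.
    destruct (Nat.eq_dec j k) as [E|E]; [apply Clim_const|].
    apply term_limit. intros E'. apply E. symmetry. now apply (pole_inj p lambda lambda_root).
- eexists. apply Clim_minus.
  + apply Clim_le_filter with (1 := nhds'_le x). apply Cdiff_cont.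
    apply Cdiff_f_up; [lra | exact Hz].
  + apply Clim_sum. intros j Hj. apply term_limit. intros E. apply Hz. rewrite E.
    now apply pole_zero.
Qed.

(** The pole at the origin is the left end point of the segment, so only half of
    the mass of its Poisson kernel is integrated. *)
Definition half_weight (j : nat) : R :=
  match j with O => weight p 0 / 2 | S k => weight p (lambda (S k)) end.
Definition pole_sum (n : nat) : C :=
  sum_n (G := C_AbelianMonoid) (fun j => RtoC (half_weight j) * f (pole lambda j))%C n.

Lemma filterlim_atan_pole (n j : nat) : (j <= n)%nat -> (1 <= n)%nat ->
  filterlim (fun d => atan ((INR n - pole lambda j) / d) + atan (pole lambda j / d))
    (at_right 0) (locally (if Nat.eq_dec j 0 then PI / 2 else PI)).
Proof.
intros Hj Hn.
assert (Hlt : pole lambda j < INR n).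
{ destruct j as [|k]; [simpl; apply (lt_INR 0); lia|].
  pose proof (pole_range p lambda lambda_root (S k) ltac:(lia)). apply le_INR in Hj. lra. }
destruct (Nat.eq_dec j 0) as [->|Hj0].
- simpl pole. rewrite Rminus_0_r.
  apply (filterlim_ext (fun d => atan (INR n / d))).
  { intros d. unfold Rdiv at 3. rewrite Rmult_0_l, atan_0. ring. }
  apply atan_inv_lim. simpl in Hlt. exact Hlt.
- replace PI with (PI / 2 + PI / 2) by field.
  apply (filterlim_comp_2 (G := locally (PI / 2)) (H := locally (PI / 2))).
  + apply atan_inv_lim. lra.
  + apply atan_inv_lim. pose proof (pole_range p lambda lambda_root j ltac:(lia)).
    assert (1 <= INR j) by (apply (le_INR 1); lia). lra.
  + apply (filterlim_plus (V := R_NormedModule)).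
Qed.

(** The regular part has no jump by [no_jump]; the factor [- 2 i] times [pi], or
    [pi / 2] at the origin, turns [res_at] into the weighted value of [f]. *)
Lemma jump_limit (n : nat) : (1 <= n)%nat ->
  Clim (at_right 0) (fun d => cint (jump d) 0 (INR n)) (pole_sum n).
Proof.
intros Hn. assert (Hn0 := pos_INR n).
set (at_ := fun j d => atan ((INR n - pole lambda j) / d) + atan (pole lambda j / d)).
set (reg := fun d x => (regular n (x, d) - regular n (x, (- d)%R))%C).
assert (Hsing : forall d, 0 < d -> is_RInt (V := C_R_NormedModule)
  (fun x => principal n (x, d) - principal n (x, (- d)%R))%C 0 (INR n)
  (sum_n (G := C_AbelianMonoid) (fun j => res_at j * (- (2 * Ci) * RtoC (at_ j d)))%C n)).
{ intros d Hd.
  apply (is_RInt_ext (V := C_R_NormedModule) (fun x => sum_n (G := C_AbelianMonoid)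
    (fun j => res_at j * (/ ((x, d) - pole lambda j) - / ((x, (- d)%R) - pole lambda j)))%C n)).
  - intros x _. unfold principal. rewrite <- sum_n_Cminus.
    refine (sum_n_ext (G := C_AbelianMonoid) _ _ n _). intros j.
    change ((res_at j * (/ ((x, d) - pole lambda j) - / ((x, (- d)%R) - pole lambda j)))%C =
      (res_at j / ((x, d) - pole lambda j) - res_at j / ((x, (- d)%R) - pole lambda j))%C).
    unfold Cdiv. ring.
  - apply is_cint_sum. intros j Hj. apply is_cint_scal. now apply pole_jump_integral. }
assert (Hjump : forall d, 0 < d -> cex (jump d) 0 (INR n)).
{ intros d Hd. apply cex_minus; apply cex_hline; try assumption; intros x Hx; apply Cdiff_cont;
    apply Cdiff_f_up; try lra; apply kden_nonreal; lra. }
assert (Hreg : forall d, 0 < d -> cex (reg d) 0 (INR n) /\ cint (reg d) 0 (INR n) =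
  (cint (jump d) 0 (INR n) -
   sum_n (G := C_AbelianMonoid) (fun j => res_at j * (- (2 * Ci) * RtoC (at_ j d)))%C n)%C).
{ intros d Hd. rewrite <- (cint_unique _ _ _ _ (Hsing d Hd)), <- cint_minus;
    [|now apply Hjump | eexists; now apply Hsing].
  assert (E : forall x, (jump d x - (principal n (x, d) - principal n (x, (- d)%R)))%C = reg d x).
  { intros x. unfold reg, regular, jump. ring. }
  split.
  - apply (cex_ext (fun x => jump d x - (principal n (x, d) - principal n (x, (- d)%R)))%C);
      [assumption | intros x _; apply E |].
    apply cex_minus; [now apply Hjump | eexists; now apply Hsing].
  - apply cint_ext; [assumption|]. intros x _. now rewrite E. }
apply (Clim_ext_loc (fun d => cint (reg d) 0 (INR n) +
  sum_n (G := C_AbelianMonoid) (fun j => res_at j * (- (2 * Ci) * RtoC (at_ j d)))%C n)%C).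
{ apply (at_right_pos _ 1); [lra|]. intros d Hd. rewrite (proj2 (Hreg d (proj1 Hd))). ring. }
apply (Clim_eq _ _ (0 + pole_sum n)%C); [ring|].
apply Clim_plus.
- intros eps He.
  assert (He' : 0 < eps / (INR n + 1)) by (apply Rdiv_lt_0_compat; lra).
  destruct (no_jump (regular n) 0 (INR n) _ He') as [d [Hd HJ]].
  { intros x Hx. now apply regular_limit. }
  apply (at_right_pos _ d Hd). intros e Hed.
  replace (cint (reg e) 0 (INR n) - 0)%C with (cint (reg e) 0 (INR n)) by ring.
  apply Rle_lt_trans with ((INR n - 0) * (eps / (INR n + 1))).
  + apply cint_bound; [assumption | apply Hreg; lra |].
    intros x Hx. left. apply HJ; [assumption | rewrite Rabs_pos_eq; lra | lra].
  + apply Rlt_le_trans with ((INR n + 1) * (eps / (INR n + 1))).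
    * apply Rmult_lt_compat_r; lra.
    * right. field. lra.
- unfold pole_sum. apply Clim_sum. intros j Hj.
  apply (Clim_eq _ _ (res_at j * (- (2 * Ci) * RtoC (if Nat.eq_dec j 0 then PI / 2 else PI)))%C).
  + unfold res_at, residue. pose proof PI_RGT_0.
    assert (E : forall w t : R, (Ci * RtoC w * f (pole lambda j) * (- (2 * Ci) * RtoC t))%C
      = (RtoC (2 * (w * t)) * f (pole lambda j))%C).
    { intros w t. rewrite !RtoC_mult.
      transitivity (- (2 * (Ci * Ci)) * RtoC w * RtoC t * f (pole lambda j))%C; [ring|].
      rewrite Ci_sqr. ring. }
    rewrite E. f_equal. f_equal.
    destruct j as [|k]; simpl; field; lra.
  + apply Clim_mult; [apply Clim_const|]. apply Clim_mult; [apply Clim_const|].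
    intros eps He.
    generalize (proj1 (filterlim_locally _ _) (filterlim_atan_pole n j Hj Hn) (mkposreal _ He)).
    apply filter_imp. intros d Hd. rewrite <- RtoC_minus, Cmod_R. exact Hd.
Qed.

(** The pole of the kernel at [0] cancels: the principal parts of [f_up] at
    [i y] and at [- i y] are opposite. *)
Lemma axis_limit : exists L, Clim (at_right 0) axis L.
Proof.
destruct (pole_limit p p_pos f 0) as [v Hv].
{ apply f_diff. simpl. lra. }
{ exact (pole_zero p lambda p_pos lambda_root 0). }
set (g := fun z => (f z * ckernel p z - residue p 0 * f 0 / (z - 0))%C) in *.
assert (Fl : forall s : R, s <> 0 -> filterlim (fun y : R => (0%R, (s * y)%R) : C) (at_right 0) (nhds' 0)).
{ intros s Hs P HP. destruct (proj1 (nhds_Cmod _ _) HP) as [d [Hd HPd]].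
  assert (Ha : 0 < Rabs s) by now apply Rabs_pos_lt.
  apply (at_right_pos _ (d / Rabs s)); [now apply Rdiv_lt_0_compat|]. intros y Hy. apply HPd.
  - replace ((0%R, (s * y)%R) - 0)%C with (Ci * RtoC (s * y))%C
      by (unfold Ci, RtoC, Cmult, Cminus, Cplus, Copp; simpl; f_equal; ring).
    rewrite Cmod_mult, Cmod_Ci, Cmod_R, Rmult_1_l, Rabs_mult, (Rabs_pos_eq y) by lra.
    apply Rmult_lt_reg_r with (/ Rabs s); [now apply Rinv_0_lt_compat|].
    replace (Rabs s * y * / Rabs s) with y by (field; lra). exact (proj2 Hy).
  - intros E. injection E. intros E'. apply Rmult_integral in E'. destruct E'; lra. }
(* Approach the pole along both halves of the imaginary axis. *)
assert (L1 := Clim_comp _ _ _ g _ (Fl 1 ltac:(lra)) Hv).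
assert (L2 := Clim_comp _ _ _ g _ (Fl (-1) ltac:(lra)) Hv).
assert (L3 : Clim (at_right 0) (fun y => f (0%R, (-1 * y)%R)) (f 0)).
{ apply (Clim_comp _ _ _ f _ (Fl (-1) ltac:(lra))).
  apply Clim_le_filter with (1 := nhds'_le 0). apply Cdiff_cont, f_diff. simpl. lra. }
eexists.
apply (Clim_ext_loc (fun y => g (0%R, (1 * y)%R) + g (0%R, (-1 * y)%R) + f (0%R, (-1 * y)%R))%C);
  [|exact (Clim_plus _ _ _ _ (Clim_plus _ _ _ _ L1 L2) L3)].
apply (at_right_pos _ 1); [lra|]. intros y Hy. rewrite axis_eq by lra.
replace (1 * y) with y by ring. replace (-1 * y) with (- y) by ring.
unfold g, f_up, f_down.
replace ((0%R, (- y)%R) - 0)%C with (- ((0%R, y) - 0))%C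
  by (unfold RtoC, Cminus, Cplus, Copp; simpl; f_equal; ring).
assert (H0 : ((0%R, y) - 0)%C <> 0).
{ intros E. apply (f_equal snd) in E. unfold RtoC, Cminus, Cplus, Copp in E. simpl in E. lra. }
set (w := ((0%R, y) - 0)%C) in *. clearbody w. field. assumption.
Qed.

Lemma axis_cex (b : R) : 0 <= b -> cex axis 0 b.
Proof.
intros Hb. destruct axis_limit as [L HL]. apply (cex_right_limit axis L); [assumption| |assumption].
intros y Hy.
assert (Hloc : locally y (fun t => 0 < t)) by (apply (open_gt 0); lra).
rewrite axis_eq by lra.
apply (Clim_ext_loc (fun y => f_up (0%R, y) - f_down (0%R, (- y)%R))%C).
{ revert Hloc. apply filter_imp. intros t Ht. symmetry. now apply axis_eq. }
apply Clim_minus.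
- apply Ccont_vline, Cdiff_cont, Cdiff_f_up; [lra|]. apply kden_nonreal; lra.
- apply (Clim_comp _ (locally (- y)) (fun t => - t) (fun t => f_down (0%R, t))).
  + apply (filterlim_opp (V := R_NormedModule)).
  + apply Ccont_vline, Cdiff_cont, Cdiff_f_down; [lra|]. apply kden_nonreal; lra.
Qed.

Lemma side_den (n : nat) (y : R) : (1 <= n)%nat -> kden p (INR n, y) <> 0.
Proof.
intros Hn. destruct (Rle_or_lt 0 y) as [Hy|Hy].
- now apply ckernel_right.
- apply kden_nonreal; lra.
Qed.

Lemma side_cont (n : nat) (y : R) : (1 <= n)%nat -> Clim (locally y) (side n) (side n y).
Proof.
intros Hn. pose proof (pos_INR n). apply Clim_minus.
- apply Ccont_vline, Cdiff_cont, Cdiff_f_up; [assumption | now apply side_den].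
- apply (Clim_comp _ (locally (- y)) (fun t => - t) (fun t => f_down (INR n, t))).
  + apply (filterlim_opp (V := R_NormedModule)).
  + apply Ccont_vline, Cdiff_cont, Cdiff_f_down; [assumption | now apply side_den].
Qed.

Lemma side_cex (n : nat) (b : R) : (1 <= n)%nat -> 0 <= b -> cex (side n) 0 b.
Proof. intros Hn Hb. apply cex_cont; [assumption|]. intros y _. now apply side_cont. Qed.

Lemma real_axis_cex (b : R) : 0 <= b -> cex (fun x => f (RtoC x)) 0 b.
Proof.
intros Hb. apply (cex_hline f 0 b 0 Hb). intros x Hx. apply Cdiff_cont, f_diff. simpl. lra.
Qed.

(** [contour_identity] in the limit of rectangles touching the real axis. *)
Lemma truncated_identity (n : nat) (Y : R) : (1 <= n)%nat -> 0 < Y ->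
  (Ci * cint axis 0 Y)%C =
  (pole_sum n - cint (fun x => f (RtoC x)) 0 (INR n) - caps n Y + Ci * cint (side n) 0 Y)%C.
Proof.
intros Hn HY. assert (Hn0 := pos_INR n).
apply (Clim_unique (F := at_right 0) (fun d => Ci * cint axis d Y)%C).
- apply Clim_mult; [apply Clim_const|]. destruct axis_limit as [L HL].
  apply (cint_lower_lim axis L); [assumption | apply axis_cex; lra | assumption].
- apply (Clim_ext_loc (fun d => cint (jump d) 0 (INR n) - cint (below d) 0 (INR n)
    - caps n Y + Ci * cint (side n) d Y)%C).
  { apply (at_right_pos _ Y HY). intros d Hd. symmetry. apply contour_identity; [assumption | lra]. }
  apply Clim_plus.
  + apply Clim_minus; [|apply Clim_const]. apply Clim_minus; [now apply jump_limit|].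
    intros eps He.
    assert (He' : 0 < eps / (INR n + 1)) by (apply Rdiv_lt_0_compat; lra).
    destruct (uniform_below f 0 (INR n) _ He') as [d [Hd HB]].
    { intros x Hx. apply Cdiff_cont, f_diff. simpl. lra. }
    apply (at_right_pos _ d Hd). intros e Hed.
    assert (Hb : cex (below e) 0 (INR n)).
    { apply (cex_hline f 0 (INR n) (- e) Hn0). intros x Hx. apply Cdiff_cont, f_diff. simpl. lra. }
    rewrite <- cint_minus; [|assumption | now apply real_axis_cex].
    apply Rle_lt_trans with ((INR n - 0) * (eps / (INR n + 1))).
    * apply cint_bound; [assumption | apply cex_minus; [assumption | now apply real_axis_cex] |].
      intros x Hx. left. apply HB; [assumption | rewrite Rabs_pos_eq; lra].
    * apply Rlt_le_trans with ((INR n + 1) * (eps / (INR n + 1))).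
      -- apply Rmult_lt_compat_r; lra.
      -- right. field. lra.
  + apply Clim_mult; [apply Clim_const|].
    apply (cint_lower_lim (side n) (side n 0)); [assumption | apply side_cex; [assumption | lra] |].
    apply (Clim_le_filter (F := locally 0)); [|now apply side_cont].
    apply filter_le_within.
Qed.

End Summation.

(** * The summation formula *)

Section Limits.
Variables (p : R) (f : C -> C).
Hypothesis p_pos : 0 < p.
Hypothesis f_diff : forall z : C, 0 <= fst z -> Cdiff f z.

Lemma Cmod_f_down (x y : R) : kden p (x, y) <> 0 ->
  Cmod (f_down p f (x, (- y)%R)) = Cmod (f (x, (- y)%R)) * Cmod (ckernel p (x, y)).
Proof.
intros H. unfold f_down. rewrite Cmod_mult, (proj2 (ckernel_reflect p x y H)), Cmod_conj.
reflexivity.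
Qed.

Lemma caps_limit (n : nat) :
  (forall eps : R, 0 < eps -> exists Y : R, forall x y : R, 0 <= x <= INR n -> Y <= y ->
     Cmod (f (x, y)) * exp (- (2 * PI * y)) < eps /\
     Cmod (f (x, - y)) * exp (- (2 * PI * y)) < eps) ->
  Clim (Rbar_locally p_infty) (caps p f n) 0.
Proof.
intros Hgrow eps He. assert (Hn0 := pos_INR n).
set (M := eps / (4 * (INR n + 1))).
assert (HM : 0 < M) by (apply Rdiv_lt_0_compat; lra).
assert (HMe : 4 * (INR n + 1) * M = eps) by (unfold M; field; lra).
destruct (Hgrow M HM) as [Y HY]. exists (Rmax 1 Y). intros y Hy.
pose proof (Rmax_l 1 Y). pose proof (Rmax_r 1 Y).
replace (caps p f n y - 0)%C with (caps p f n y) by ring. unfold caps.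
assert (Hden : forall x, kden p (x, y) <> 0) by (intros; apply kden_nonreal; lra).
assert (B : forall g : R -> C, cex g 0 (INR n) ->
  (forall x, 0 <= x <= INR n -> Cmod (g x) <= 2 * M) ->
  Cmod (cint g 0 (INR n)) <= (INR n - 0) * (2 * M)) by (intros; now apply cint_bound).
eapply Rle_lt_trans; [apply Cmod_triangle|].
apply Rle_lt_trans with ((INR n - 0) * (2 * M) + (INR n - 0) * (2 * M)); [|lra].
pose proof (exp_pos (- (2 * PI * y))).
apply Rplus_le_compat; apply B.
- apply cex_hline; [assumption|]. intros x Hx. apply Cdiff_cont, Cdiff_f_up; auto; lra.
- intros x Hx. unfold f_up. rewrite Cmod_mult.
  destruct (HY x y Hx ltac:(lra)) as [H2 _].
  pose proof (ckernel_top p p_pos x y ltac:(lra)). pose proof (Cmod_ge_0 (f (x, y))). nra.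
- apply (cex_hline (f_down p f) 0 (INR n) (- y)); [assumption|]. intros x Hx.
  apply Cdiff_cont, Cdiff_f_down; auto; [lra|]. apply kden_nonreal; lra.
- intros x Hx. rewrite Cmod_f_down by apply Hden.
  destruct (HY x y Hx ltac:(lra)) as [_ H2].
  pose proof (ckernel_top p p_pos x y ltac:(lra)). pose proof (Cmod_ge_0 (f (x, (- y)%R))). nra.
Qed.

(** The bounds of the kernel on the line [Re z = n] and on its reflection give a
    majorant whose integral over the half-line is [p + 2] times [L]. *)
Lemma side_limit (n : nat) (L : R) : (1 <= n)%nat ->
  is_RInt_gen (V := R_NormedModule)
    (fun y : R => exp (- (2 * PI * Rabs y)) * Cmod (f (INR n, y)))
    (Rbar_locally m_infty) (Rbar_locally p_infty) L ->
  exists v, Clim (Rbar_locally p_infty) (fun b => cint (side p f n) 0 b) v /\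
    Cmod v <= (p + 2) * L.
Proof.
intros Hn HL.
apply (is_RInt_gen_scal (V := R_NormedModule) _ (p + 2)) in HL.
destruct (RInt_gen_symmetric _ _ HL) as [Hex Hlim].
apply (cint_dominated _ _ _ (fun b Hb => side_cex p f p_pos f_diff n b Hn Hb) Hex); [|exact Hlim].
intros y Hy. destruct (ckernel_right p p_pos n y Hn Hy) as [H0 Hk].
unfold scal; simpl; unfold mult; simpl.
rewrite Rabs_Ropp, Rabs_pos_eq by assumption.
unfold side. eapply Rle_trans; [apply Cmod_sub_le|].
rewrite Cmod_f_down by assumption. unfold f_up. rewrite Cmod_mult.
apply Rle_trans with (Cmod (f (INR n, y)) * ((p + 2) * exp (- (2 * PI * y)))
  + Cmod (f (INR n, (- y)%R)) * ((p + 2) * exp (- (2 * PI * y)))); [|right; ring].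
apply Rplus_le_compat; apply Rmult_le_compat_l; try apply Cmod_ge_0; assumption.
Qed.

End Limits.

Theorem theorem5p2 (p : R) (lambda : nat -> R) (f : C -> C)
  (p_pos : 0 < p)
  (lambda_root : forall j : nat, (1 <= j)%nat ->
     INR j - 1 / 2 < lambda j < INR j /\
     tan (PI * lambda j) = - lambda j / p)
  (f_analytic : analytic_right_half_plane f)
  (f_int_horizontal : forall y : R,
     ex_RInt_gen (V := R_NormedModule) (fun x : R => Cmod (f (x, y)))
       (at_point 0) (Rbar_locally p_infty))
  (f_int_horizontal_bounded : exists M Y : R, forall y : R, Y <= Rabs y ->
     RInt_gen (V := R_CompleteNormedModule) (fun x : R => Cmod (f (x, y)))
       (at_point 0) (Rbar_locally p_infty) <= M)
  (f_growth : forall a b : R, 0 <= a -> forall eps : R, 0 < eps ->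
     exists Y : R, forall x y : R, a <= x <= b -> Y <= y ->
       Cmod (f (x, y)) * exp (- (2 * PI * y)) < eps /\
       Cmod (f (x, - y)) * exp (- (2 * PI * y)) < eps)
  (f_int_vertical : Rbar_locally p_infty (fun r : R =>
     ex_RInt_gen (V := R_NormedModule)
       (fun y : R => exp (- (2 * PI * Rabs y)) * Cmod (f (r, y)))
       (Rbar_locally m_infty) (Rbar_locally p_infty)))
  (f_int_vertical_lim : is_lim (fun r : R =>
     RInt_gen (V := R_CompleteNormedModule)
       (fun y : R => exp (- (2 * PI * Rabs y)) * Cmod (f (r, y)))
       (Rbar_locally m_infty) (Rbar_locally p_infty)) p_infty 0)
  (f_series : ex_series (K := C_AbsRing) (V := C_NormedModule)
     (fun k : nat => f (RtoC (lambda (S k))))) :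
  exists I J : C,
    is_RInt_gen (V := C_R_NormedModule) (fun x : R => f (RtoC x))
      (at_point 0) (Rbar_locally p_infty) I /\
    is_RInt_gen (V := C_R_NormedModule)
      (fun x : R => ((f (0%R, x) - f (0%R, (- x)%R)) * RtoC (kernel p x))%C)
      (at_point 0) (Rbar_locally p_infty) J /\
    is_series (K := C_AbsRing) (V := C_NormedModule)
      (fun k : nat =>
         (RtoC ((p ^ 2 + lambda (S k) ^ 2) /
                (p * (p + 1 / PI) + lambda (S k) ^ 2)) *
          f (RtoC (lambda (S k))))%C)
      (- RtoC (1 / 2) * RtoC (1 / (1 + 1 / (PI * p))) * f (RtoC 0)
       + I + Ci * J)%C.
Proof.
assert (f_diff : forall z : C, 0 <= fst z -> Cdiff f z).
{ intros z Hz. apply Cdiff_of_ex_derive. exact (locally_singleton _ _ (f_analytic z Hz)). }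
destruct (RInt_gen_0_infty _ (f_int_horizontal 0)) as [L0 [Hex0 Hlim0]].
destruct (cint_dominated (fun x => f (RtoC x)) _ L0 (real_axis_cex f f_diff) Hex0
  (fun x _ => Rle_refl _) Hlim0) as [I [HI _]].
set (beta := fun n : nat => RInt_gen (V := R_CompleteNormedModule)
  (fun y : R => exp (- (2 * PI * Rabs y)) * Cmod (f (INR n, y)))
  (Rbar_locally m_infty) (Rbar_locally p_infty)).
destruct f_int_vertical as [r0 Hr0].
destruct (nfloor_ex (Rmax 0 r0) (Rmax_l 0 r0)) as [n0 Hn0].
assert (Hlarge : forall n, (S n0 <= n)%nat -> (1 <= n)%nat /\ r0 < INR n).
{ intros n Hn. split; [lia|]. apply le_INR in Hn. rewrite S_INR in Hn.
  pose proof (Rmax_r 0 r0). lra. }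
assert (Haxis : forall n, (S n0 <= n)%nat -> exists v,
  Clim (Rbar_locally p_infty) (fun b => Ci * cint (axis p f) 0 b)%C
    (pole_sum p lambda f n - cint (fun x => f (RtoC x)) 0 (INR n) + Ci * v)%C /\
  Cmod v <= (p + 2) * beta n).
{ intros n Hn. destruct (Hlarge n Hn) as [Hn1 Hnr].
  assert (Hb := RInt_gen_correct (V := R_CompleteNormedModule) _ (Hr0 (INR n) Hnr)).
  destruct (side_limit p f p_pos f_diff n _ Hn1 Hb) as [v [Hv Hle]].
  exists v. split; [|exact Hle].
  apply (Clim_ext_loc (fun b => pole_sum p lambda f n - cint (fun x => f (RtoC x)) 0 (INR n)
    - caps p f n b + Ci * cint (side p f n) 0 b)%C).
  { exists 0. intros b Hb0. symmetry. now apply truncated_identity. }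
  apply Clim_plus; [|apply Clim_mult; [apply Clim_const | exact Hv]].
  apply (Clim_eq _ _ (pole_sum p lambda f n - cint (fun x => f (RtoC x)) 0 (INR n) - 0)%C); [ring|].
  apply Clim_minus; [apply Clim_const|]. apply caps_limit; try assumption.
  apply f_growth. lra. }
(* The limit over [b] does not involve [n]: the value [iJ] found for the first
   admissible [n] is the value for all of them. *)
destruct (Haxis (S n0) (le_n _)) as [v0 [Hv0 _]].
set (iJ := (pole_sum p lambda f (S n0) - cint (fun x => f (RtoC x)) 0 (INR (S n0)) + Ci * v0)%C) in *.
set (J := (- Ci * iJ)%C).
assert (HiJ : (Ci * J)%C = iJ).
{ unfold J. transitivity (- (Ci * Ci) * iJ)%C; [ring|]. rewrite Ci_sqr. ring. }
exists I, J. split; [|split].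
- apply is_cint_gen; [|exact HI]. intros b Hb. apply real_axis_cex; [assumption | lra].
- apply (is_cint_gen (axis p f)).
  + intros b Hb. apply (axis_cex p lambda f); try assumption. lra.
  + apply (Clim_ext_loc (fun b => - Ci * (Ci * cint (axis p f) 0 b))%C).
    { apply filter_forall. intros b. transitivity (- (Ci * Ci) * cint (axis p f) 0 b)%C; [ring|].
      rewrite Ci_sqr. ring. }
    apply Clim_mult; [apply Clim_const | exact Hv0].
- assert (Hinf : filterlim INR eventually (Rbar_locally p_infty)) by exact is_lim_seq_INR.
  assert (Hbeta : filterlim (fun n => (p + 2) * beta n) eventually (locally 0)).
  { replace 0 with ((p + 2) * 0) by ring.
    apply (filterlim_comp _ _ _ beta (fun t => (p + 2) * t) _ (locally 0)).
    - exact (filterlim_comp _ _ _ INR _ _ _ _ Hinf f_int_vertical_lim).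
    - apply (filterlim_scal_r (V := R_NormedModule) (p + 2) 0). }
  assert (HS : Clim eventually (pole_sum p lambda f) (I + iJ)%C).
  { apply (Clim_ext_loc (fun n => cint (fun x => f (RtoC x)) 0 (INR n)
      + (pole_sum p lambda f n - cint (fun x => f (RtoC x)) 0 (INR n)))%C).
    { apply filter_forall. intros n. ring. }
    apply Clim_plus; [exact (Clim_comp _ _ INR _ _ Hinf HI)|].
    apply (Clim_squeeze _ (fun n => (p + 2) * beta n)); [|exact Hbeta].
    exists (S n0). intros n Hn. destruct (Haxis n Hn) as [v [Hv Hle]].
    rewrite <- (Clim_unique _ _ _ Hv Hv0) at 1.
    replace (pole_sum p lambda f n - cint (fun x => f (RtoC x)) 0 (INR n) -
      (pole_sum p lambda f n - cint (fun x => f (RtoC x)) 0 (INR n) + Ci * v))%C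
      with (- (Ci * v))%C by ring.
    rewrite Cmod_opp, Cmod_mult, Cmod_Ci, Rmult_1_l. exact Hle. }
  rewrite HiJ.
  assert (Hhalf : RtoC (half_weight p lambda 0) = (RtoC (1 / 2) * RtoC (1 / (1 + 1 / (PI * p))))%C).
  { rewrite <- RtoC_mult. f_equal. unfold half_weight, weight. pose proof PI_RGT_0.
    field. repeat split; nra. }
  apply (Clim_filterlim eventually).
  apply (Clim_ext_loc (fun n => pole_sum p lambda f (S n)
    - RtoC (1 / 2) * RtoC (1 / (1 + 1 / (PI * p))) * f (RtoC 0))%C).
  { apply filter_forall. intros n. rewrite <- Hhalf. induction n as [|n IH].
    - unfold pole_sum. rewrite sum_Sn, !sum_O. unfold plus, half_weight, weight; simpl. ring.
    - rewrite sum_Sn, <- IH. unfold pole_sum. rewrite (sum_Sn _ (S n)).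
      unfold plus, half_weight, weight; simpl. ring. }
  apply (Clim_eq _ _ ((I + iJ) - RtoC (1 / 2) * RtoC (1 / (1 + 1 / (PI * p))) * f (RtoC 0))%C); [ring|].
  apply Clim_minus; [|apply Clim_const].
  apply (Clim_comp _ eventually S _ _); [|exact HS].
  intros P [N HN]. exists N. intros n Hn. apply HN. lia.
Qed.
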